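(* Let $(\mathfrak g,\mathfrak h,\rho,\psi)$ be a matched pair of 3-Lie algebras over a field $\mathbf k$ and let $(V,W,\alpha,\beta)$ be a representation of it, with action maps $\rho_V,\psi_V,\rho_W,\psi_W$. Let $\mathrm{Ext}(\mathfrak g,\mathfrak h;V,W)$ be the set of isomorphism classes of abelian extensions of $(\mathfrak g,\mathfrak h,\rho,\psi)$ by $(V,W)$ whose induced representation is the given one. Then these isomorphism classes are classified by the second cohomology group, i.e. there is a bijection $$\mathrm{Ext}(\mathfrak g,\mathfrak h;V,W)\ \longleftrightarrow\ H^2_{\mathrm{MPL}}(\mathfrak g,\mathfrak h;V,W).$$
   Context: A 3-Lie algebra is a vector space $\mathfrak g$ with a linear map $[\cdot,\cdot,\cdot]:\wedge^3\mathfrak g\to\mathfrak g$ satisfying $[x_1,x_2,[y_1,y_2,y_3]]=[[x_1,x_2,y_1],y_2,y_3]+[y_1,[x_1,x_2,y_2],y_3]+[y_1,y_2,[x_1,x_2,y_3]]$. A representation of $\mathfrak g$ on $V$ is a trilinear map $\rho_V:\mathfrak g\times\mathfrak g\times V\to V$, alternating in the first two arguments, with $\rho_V(x_1,x_2)\rho_V(x_3,x_4)-\rho_V(x_3,x_4)\rho_V(x_1,x_2)=\rho_V([x_1,x_2,x_3],x_4)+\rho_V(x_3,[x_1,x_2,x_4])$ and $\rho_V([x_1,x_2,x_3],x_4)=\rho_V(x_1,x_2)\rho_V(x_3,x_4)+\rho_V(x_2,x_3)\rho_V(x_1,x_4)+\rho_V(x_3,x_1)\rho_V(x_2,x_4)$.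 A matched pair of 3-Lie algebras is a quadruple $(\mathfrak g,\mathfrak h,\rho,\psi)$ with $\mathfrak g,\mathfrak h$ 3-Lie algebras and trilinear maps $\rho:\mathfrak g\times\mathfrak g\times\mathfrak h\to\mathfrak h$, $\psi:\mathfrak h\times\mathfrak h\times\mathfrak g\to\mathfrak g$, alternating in the first two arguments, such that for all $x_i\in\mathfrak g$, $a_i\in\mathfrak h$: (M1) $\psi(a_1,a_2)[x_1,x_2,x_3]=[\psi(a_1,a_2)x_1,x_2,x_3]+[x_1,\psi(a_1,a_2)x_2,x_3]+[x_1,x_2,\psi(a_1,a_2)x_3]$; (M2) $-\psi(\rho(x_1,x_2)a_1,a_2)x_3=-\psi(\rho(x_1,x_3)a_2,a_1)x_2+\psi(\rho(x_2,x_3)a_2,a_1)x_1-[x_1,x_2,\psi(a_1,a_2)x_3]$; (M3) $[\psi(a_1,a_2)x_1,x_2,x_3]=\psi(a_1,a_2)[x_1,x_2,x_3]+\psi(\rho(x_2,x_3)a_1,a_2)x_1+\psi(a_1,\rho(x_2,x_3)a_2)x_1$; (M4) $\rho(x_1,x_2)[a_1,a_2,a_3]=[\rho(x_1,x_2)a_1,a_2,a_3]+[a_1,\rho(x_1,x_2)a_2,a_3]+[a_1,a_2,\rho(x_1,x_2)a_3]$; (M5) $-\rho(\psi(a_1,a_2)x_1,x_2)a_3=-\rho(\psi(a_1,a_3)x_2,x_1)a_2+\rho(\psi(a_2,a_3)x_2,x_1)a_1-[a_1,a_2,\rho(x_1,x_2)a_3]$; (M6) $[\rho(x_1,x_2)a_1,a_2,a_3]=\rho(x_1,x_2)[a_1,a_2,a_3]+\rho(\psi(a_2,a_3)x_1,x_2)a_1+\rho(x_1,\psi(a_2,a_3)x_2)a_1$.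 A morphism of matched pairs $(\mathfrak g,\mathfrak h,\rho,\psi)\to(\mathfrak g',\mathfrak h',\rho',\psi')$ is a pair of 3-Lie algebra homomorphisms $f:\mathfrak g\to\mathfrak g'$, $g:\mathfrak h\to\mathfrak h'$ with $g(\rho(x_1,x_2)a)=\rho'(f(x_1),f(x_2))g(a)$ and $f(\psi(a_1,a_2)x)=\psi'(g(a_1),g(a_2))f(x)$. A representation of the matched pair is a quadruple $(V,W,\alpha,\beta)$ where $V$ is a representation of $\mathfrak g$ (via $\rho_V$) and of $\mathfrak h$ (via $\psi_V$), $W$ is a representation of $\mathfrak g$ (via $\rho_W$) and of $\mathfrak h$ (via $\psi_W$), and $\alpha:V\times\mathfrak g\to\mathrm{Hom}(\mathfrak h,W)$, $\beta:W\times\mathfrak h\to\mathrm{Hom}(\mathfrak g,V)$ are bilinear maps such that for all $x_i\in\mathfrak g$, $a_i\in\mathfrak h$, $v,v_i\in V$, $w,w_i\in W$: (R1) $\psi_V(a_1,a_2)\rho_V(x_1,x_2)v=\rho_V(\psi(a_1,a_2)x_1,x_2)v+\rho_V(x_1,\psi(a_1,a_2)x_2)v+\rho_V(x_1,x_2)\psi_V(a_1,a_2)v$. (R2) With $B=\beta(w_1,a_2)-\beta(w_2,a_1)$: $B[x_1,x_2,x_3]=\rho_V(x_2,x_3)Bx_1+\rho_V(x_3,x_1)Bx_2+\rho_V(x_1,x_2)Bx_3$. (R3) $\rho_V(x_1,\psi(a_1,a_2)x_2)v=\psi_V(\rho(x_1,x_2)a_2,a_1)v$. (R4) $\rho_V(x_1,x_2)\psi_V(a_1,a_2)v=\psi_V(\rho(x_1,x_2)a_1,a_2)v$.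 (R5) $\rho_V(x_1,x_2)(\beta(w_1,a_2)-\beta(w_2,a_1))x_3=\beta(\rho_W(x_2,x_3)w_2+(\alpha(v_2,x_3)-\alpha(v_3,x_2))a_2,a_1)x_1-\beta(w_1,\rho(x_2,x_3)a_2)x_1-\beta(\rho_W(x_1,x_3)w_2+(\alpha(v_1,x_3)-\alpha(v_3,x_1))a_2,a_1)x_2+\beta(w_1,\rho(x_1,x_3)a_2)x_2+\beta(\rho_W(x_1,x_2)w_1+(\alpha(v_1,x_2)-\alpha(v_2,x_1))a_1,a_2)x_3-\beta(w_2,\rho(x_1,x_2)a_1)x_3$. (R6) $\rho_V(x_1,x_2)\psi_V(a_1,a_2)v=\psi_V(a_1,a_2)\rho_V(x_1,x_2)v+\psi_V(\rho(x_1,x_2)a_1,a_2)v+\psi_V(a_1,\rho(x_1,x_2)a_2)v$. (R7) $\rho_V(x_2,x_3)(\beta(w_1,a_2)-\beta(w_2,a_1))x_1=(\beta(w_1,a_2)-\beta(w_2,a_1))[x_1,x_2,x_3]-\beta(w_2,\rho(x_2,x_3)a_1)x_1+\beta(w_1,\rho(x_2,x_3)a_2)x_1+\beta(\rho_W(x_2,x_3)w_1+(\alpha(v_2,x_3)-\alpha(v_3,x_2))a_1,a_2)x_1-\beta(\rho_W(x_2,x_3)w_2+(\alpha(v_2,x_3)-\alpha(v_3,x_2))a_2,a_1)x_1$. (R8) $\rho_V(\psi(a_1,a_2)x_1,x_2)v=\psi_V(a_1,a_2)\rho_V(x_1,x_2)v$. (R9) $\rho_W(x_1,x_2)\psi_W(a_1,a_2)w=\psi_W(\rho(x_1,x_2)a_1,a_2)w+\psi_W(a_1,\rho(x_1,x_2)a_2)w+\psi_W(a_1,a_2)\rho_W(x_1,x_2)w$.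 (R10) With $A=\alpha(v_1,x_2)-\alpha(v_2,x_1)$: $A[a_1,a_2,a_3]=\psi_W(a_2,a_3)Aa_1+\psi_W(a_3,a_1)Aa_2+\psi_W(a_1,a_2)Aa_3$. (R11) $\psi_W(a_1,\rho(x_1,x_2)a_2)w=\rho_W(\psi(a_1,a_2)x_2,x_1)w$. (R12) $\psi_W(a_1,a_2)\rho_W(x_1,x_2)w=\rho_W(\psi(a_1,a_2)x_1,x_2)w$. (R13) $\psi_W(a_1,a_2)(\alpha(v_1,x_2)-\alpha(v_2,x_1))a_3=\alpha(\psi_V(a_2,a_3)v_2+(\beta(w_2,a_3)-\beta(w_3,a_2))x_2,x_1)a_1-\alpha(v_1,\psi(a_2,a_3)x_2)a_1-\alpha(\psi_V(a_1,a_3)v_2+(\beta(w_1,a_3)-\beta(w_3,a_1))x_2,x_1)a_2+\alpha(v_1,\psi(a_1,a_3)x_2)a_2+\alpha(\psi_V(a_1,a_2)v_1+(\beta(w_1,a_2)-\beta(w_2,a_1))x_1,x_2)a_3-\alpha(v_2,\psi(a_1,a_2)x_1)a_3$. (R14) $\psi_W(a_1,a_2)\rho_W(x_1,x_2)w=\rho_W(x_1,x_2)\psi_W(a_1,a_2)w+\rho_W(\psi(a_1,a_2)x_1,x_2)w+\rho_W(x_1,\psi(a_1,a_2)x_2)w$. (R15) $\psi_W(a_2,a_3)(\alpha(v_1,x_2)-\alpha(v_2,x_1))a_1=(\alpha(v_1,x_2)-\alpha(v_2,x_1))[a_1,a_2,a_3]-\alpha(v_2,\psi(a_2,a_3)x_1)a_1+\alpha(v_1,\psi(a_2,a_3)x_2)a_1+\alpha(\psi_V(a_2,a_3)v_1+(\beta(w_2,a_3)-\beta(w_3,a_2))x_1,x_2)a_1-\alpha(\psi_V(a_2,a_3)v_2+(\beta(w_2,a_3)-\beta(w_3,a_2))x_2,x_1)a_1$.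 (R16) $\psi_W(\rho(x_1,x_2)a_1,a_2)w=\rho_W(x_1,x_2)\psi_W(a_1,a_2)w$. Abelian extension of $(\mathfrak g,\mathfrak h,\rho,\psi)$ by a pair of vector spaces $(V,W)$ (regarded as the matched pair $(V,W,0,0)$ with zero brackets): a matched pair $(\widehat{\mathfrak g},\widehat{\mathfrak h},\widehat\rho,\widehat\psi)$ with morphisms of matched pairs $(i_1,i_2):(V,W,0,0)\to(\widehat{\mathfrak g},\widehat{\mathfrak h},\widehat\rho,\widehat\psi)$ and $(j_1,j_2):(\widehat{\mathfrak g},\widehat{\mathfrak h},\widehat\rho,\widehat\psi)\to(\mathfrak g,\mathfrak h,\rho,\psi)$ such that $0\to V\xrightarrow{i_1}\widehat{\mathfrak g}\xrightarrow{j_1}\mathfrak g\to0$ and $0\to W\xrightarrow{i_2}\widehat{\mathfrak h}\xrightarrow{j_2}\mathfrak h\to0$ are exact ($V,W$ are identified with their images). A section is a pair of linear maps $s_1:\mathfrak g\to\widehat{\mathfrak g}$, $s_2:\mathfrak h\to\widehat{\mathfrak h}$ with $j_1s_1=\mathrm{id}$, $j_2s_2=\mathrm{id}$. The induced representation is given, using a section, by $\rho_V(x_1,x_2)v=[s_1x_1,s_1x_2,v]$, $\rho_W(x_1,x_2)w=\widehat\rho(s_1x_1,s_1x_2)w$, $\psi_V(a_1,a_2)v=\widehat\psi(s_2a_1,s_2a_2)v$, $\psi_W(a_1,a_2)w=[s_2a_1,s_2a_2,w]$, $\alpha(v,x)a=\widehat\rho(v,s_1x)s_2a$, $\beta(w,a)x=\widehat\psi(w,s_2a)s_1x$;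 it is taken to be independent of the section. Two abelian extensions are isomorphic if there is an isomorphism $(f,g)$ of matched pairs between the middle terms with $f i_1=i_1'$, $g i_2=i_2'$, $j_1'f=j_1$, $j_2'g=j_2$. Cohomology with coefficients in $(V,W,\alpha,\beta)$: a 2-cochain is $(\omega,\theta,\nu,\phi)$ with $\omega\in\mathrm{Hom}(\wedge^3\mathfrak g,V)$, $\theta\in\mathrm{Hom}(\wedge^3\mathfrak h,W)$, $\nu\in\mathrm{Hom}(\wedge^2\mathfrak g\otimes\mathfrak h,W)$, $\phi\in\mathrm{Hom}(\wedge^2\mathfrak h\otimes\mathfrak g,V)$. It is a 2-cocycle if: (Z1) $\rho_V(x_4,x_5)\omega(x_1,x_2,x_3)+\rho_V(x_5,x_3)\omega(x_1,x_2,x_4)+\rho_V(x_3,x_4)\omega(x_1,x_2,x_5)+\omega([x_1,x_2,x_3],x_4,x_5)+\omega(x_3,[x_1,x_2,x_4],x_5)+\omega(x_3,x_4,[x_1,x_2,x_5])=\rho_V(x_1,x_2)\omega(x_3,x_4,x_5)+\omega(x_1,x_2,[x_3,x_4,x_5])$; (Z2) the same identity with $(\mathfrak g,\rho_V,\omega)$ replaced by $(\mathfrak h,\psi_W,\theta)$; (Z3) $\rho_W(x_1,x_2)\theta(a_1,a_2,a_3)+\nu(x_1,x_2)[a_1,a_2,a_3]=\psi_W(a_2,a_3)\nu(x_1,x_2)a_1+\psi_W(a_3,a_1)\nu(x_1,x_2)a_2+\psi_W(a_1,a_2)\nu(x_1,x_2)a_3+\theta(\rho(x_1,x_2)a_1,a_2,a_3)+\theta(a_1,\rho(x_1,x_2)a_2,a_3)+\theta(a_1,a_2,\rho(x_1,x_2)a_3)$;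 (Z4) $\psi_V(a_1,a_2)\omega(x_1,x_2,x_3)+\phi(a_1,a_2)[x_1,x_2,x_3]=\rho_V(x_2,x_3)\phi(a_1,a_2)x_1+\rho_V(x_3,x_1)\phi(a_1,a_2)x_2+\rho_V(x_1,x_2)\phi(a_1,a_2)x_3+\omega(\psi(a_1,a_2)x_1,x_2,x_3)+\omega(x_1,\psi(a_1,a_2)x_2,x_3)+\omega(x_1,x_2,\psi(a_1,a_2)x_3)$; (Z5) $\beta(\nu(x_1,x_2)a_1,a_2)x_3+\phi(\rho(x_1,x_2)a_1,a_2)x_3=\beta(\nu(x_1,x_3)a_2,a_1)x_2+\phi(\rho(x_1,x_3)a_2,a_1)x_2-\beta(\nu(x_2,x_3)a_2,a_1)x_1-\phi(\rho(x_2,x_3)a_2,a_1)x_1+\rho_V(x_1,x_2)\phi(a_1,a_2)x_3+\omega(x_1,x_2,\psi(a_1,a_2)x_3)$; (Z6) $\alpha(\phi(a_1,a_2)x_1,x_2)a_3+\nu(\psi(a_1,a_2)x_1,x_2)a_3=\alpha(\phi(a_1,a_3)x_2,x_1)a_2+\nu(\psi(a_1,a_3)x_2,x_1)a_2-\alpha(\phi(a_2,a_3)x_2,x_1)a_1-\nu(\psi(a_2,a_3)x_2,x_1)a_1+\psi_W(a_1,a_2)\nu(x_1,x_2)a_3+\theta(a_1,a_2,\rho(x_1,x_2)a_3)$; (Z7) $\omega(\psi(a_1,a_2)x_1,x_2,x_3)+\rho_V(x_2,x_3)\phi(a_1,a_2)x_1=\psi_V(a_1,a_2)\omega(x_1,x_2,x_3)+\phi(a_1,a_2)[x_1,x_2,x_3]+\phi(\rho(x_2,x_3)a_1,a_2)x_1+\beta(\nu(x_2,x_3)a_1,a_2)x_1+\phi(a_1,\rho(x_2,x_3)a_2)x_1-\beta(\nu(x_2,x_3)a_2,a_1)x_1$;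 (Z8) $\theta(\rho(x_1,x_2)a_1,a_2,a_3)+\psi_W(a_2,a_3)\nu(x_1,x_2)a_1=\rho_W(x_1,x_2)\theta(a_1,a_2,a_3)+\nu(x_1,x_2)[a_1,a_2,a_3]+\nu(\psi(a_2,a_3)x_1,x_2)a_1+\alpha(\phi(a_2,a_3)x_1,x_2)a_1+\nu(x_1,\psi(a_2,a_3)x_2)a_1-\alpha(\phi(a_2,a_3)x_2,x_1)a_1$. For $(N_1,N_2)\in\mathrm{Hom}(\mathfrak g,V)\oplus\mathrm{Hom}(\mathfrak h,W)$ the 2-coboundary $D_1(N_1,N_2)=(\omega,\theta,\nu,\phi)$ is $\omega(x_1,x_2,x_3)=\rho_V(x_2,x_3)N_1x_1+\rho_V(x_3,x_1)N_1x_2+\rho_V(x_1,x_2)N_1x_3-N_1[x_1,x_2,x_3]$, $\theta(a_1,a_2,a_3)=\psi_W(a_2,a_3)N_2a_1+\psi_W(a_3,a_1)N_2a_2+\psi_W(a_1,a_2)N_2a_3-N_2[a_1,a_2,a_3]$, $\nu(x_1,x_2)a=\rho_W(x_1,x_2)N_2a-N_2(\rho(x_1,x_2)a)+\alpha(N_1x_1,x_2)a-\alpha(N_1x_2,x_1)a$, $\phi(a_1,a_2)x=\psi_V(a_1,a_2)N_1x-N_1(\psi(a_1,a_2)x)+\beta(N_2a_1,a_2)x-\beta(N_2a_2,a_1)x$. $H^2_{\mathrm{MPL}}(\mathfrak g,\mathfrak h;V,W)$ is the quotient of 2-cocycles by 2-coboundaries (2-coboundaries being 2-cocycles).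
   Formalization: Independence of the induced representation from the section is taken to mean that all products with two entries from (V,W) vanish; this is equivalent when dim g, dim h ≥ 2, while in small dimensions independence over linear sections alone is too weak and the claim fails. *)

(* Defs.v *)
From mathcomp Require Import all_boot all_algebra.
Set Implicit Arguments.
Unset Strict Implicit.
Unset Printing Implicit Defensive.
Import GRing.Theory.
Local Open Scope ring_scope.

(* All vector spaces are of arbitrary dimension over a field of arbitrary
   characteristic, so "alternating" is vanishing on repeated arguments.
   A map on wedge^3 A is a trilinear alternating3 map, a map on
   (wedge^2 A) (x) B a trilinear alternating2 map, and a bilinear map
   A x B -> Hom(C, D) a (curried) trilinear map. *)

Definition trilinear (k : fieldType) (A B C D : lmodType k)
    (f : A -> B -> C -> D) : Prop :=
  [/\ forall b c, linear (fun a => f a b c),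
      forall a c, linear (fun b => f a b c)
    & forall a b, linear (fun c => f a b c)].

Definition alternating2 (k : fieldType) (A B C : lmodType k)
    (f : A -> A -> B -> C) : Prop :=
  forall a b, f a a b = 0.

Definition alternating3 (k : fieldType) (A B : lmodType k)
    (f : A -> A -> A -> B) : Prop :=
  forall a b, [/\ f a a b = 0, f a b a = 0 & f b a a = 0].

Record threeLie (k : fieldType) := ThreeLie {
  tl_space :> lmodType k;
  br : tl_space -> tl_space -> tl_space -> tl_space;
  br_trilinear : trilinear br;
  br_alternating : alternating3 br;
  br_fundamental : forall x1 x2 y1 y2 y3,
    br x1 x2 (br y1 y2 y3) =
      br (br x1 x2 y1) y2 y3 + br y1 (br x1 x2 y2) y3 + br y1 y2 (br x1 x2 y3)
}.

Record is_repr (k : fieldType) (g : threeLie k) (V : lmodType k)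
    (rho : g -> g -> V -> V) : Prop := {
  repr_trilinear : trilinear rho;
  repr_alternating : alternating2 rho;
  repr_comm : forall x1 x2 x3 x4 v,
    rho x1 x2 (rho x3 x4 v) - rho x3 x4 (rho x1 x2 v) =
      rho (br x1 x2 x3) x4 v + rho x3 (br x1 x2 x4) v;
  repr_br : forall x1 x2 x3 x4 v,
    rho (br x1 x2 x3) x4 v =
      rho x1 x2 (rho x3 x4 v) + rho x2 x3 (rho x1 x4 v)
      + rho x3 x1 (rho x2 x4 v)
}.

Record is_matched_pair (k : fieldType) (g h : threeLie k)
    (rho : g -> g -> h -> h) (psi : h -> h -> g -> g) : Prop := {
  mp_rho_trilinear : trilinear rho;
  mp_rho_alternating : alternating2 rho;
  mp_psi_trilinear : trilinear psi;
  mp_psi_alternating : alternating2 psi;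
  mp_M1 : forall a1 a2 x1 x2 x3,
    psi a1 a2 (br x1 x2 x3) =
      br (psi a1 a2 x1) x2 x3 + br x1 (psi a1 a2 x2) x3
      + br x1 x2 (psi a1 a2 x3);
  mp_M2 : forall a1 a2 x1 x2 x3,
    - psi (rho x1 x2 a1) a2 x3 =
      - psi (rho x1 x3 a2) a1 x2 + psi (rho x2 x3 a2) a1 x1
      - br x1 x2 (psi a1 a2 x3);
  mp_M3 : forall a1 a2 x1 x2 x3,
    br (psi a1 a2 x1) x2 x3 =
      psi a1 a2 (br x1 x2 x3) + psi (rho x2 x3 a1) a2 x1
      + psi a1 (rho x2 x3 a2) x1;
  mp_M4 : forall x1 x2 a1 a2 a3,
    rho x1 x2 (br a1 a2 a3) =
      br (rho x1 x2 a1) a2 a3 + br a1 (rho x1 x2 a2) a3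
      + br a1 a2 (rho x1 x2 a3);
  mp_M5 : forall x1 x2 a1 a2 a3,
    - rho (psi a1 a2 x1) x2 a3 =
      - rho (psi a1 a3 x2) x1 a2 + rho (psi a2 a3 x2) x1 a1
      - br a1 a2 (rho x1 x2 a3);
  mp_M6 : forall x1 x2 a1 a2 a3,
    br (rho x1 x2 a1) a2 a3 =
      rho x1 x2 (br a1 a2 a3) + rho (psi a2 a3 x1) x2 a1
      + rho x1 (psi a2 a3 x2) a1
}.

Record matchedPair (k : fieldType) := MatchedPair {
  mp_g : threeLie k;
  mp_h : threeLie k;
  mp_rho : mp_g -> mp_g -> mp_h -> mp_h;
  mp_psi : mp_h -> mp_h -> mp_g -> mp_g;
  mpP : is_matched_pair mp_rho mp_psi
}.

Record is_mp_morphism (k : fieldType) (M M' : matchedPair k)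
    (f : {linear mp_g M -> mp_g M'}) (g : {linear mp_h M -> mp_h M'}) : Prop := {
  mor_br_g : forall x1 x2 x3, f (br x1 x2 x3) = br (f x1) (f x2) (f x3);
  mor_br_h : forall a1 a2 a3, g (br a1 a2 a3) = br (g a1) (g a2) (g a3);
  mor_rho : forall x1 x2 a, g (mp_rho x1 x2 a) = mp_rho (f x1) (f x2) (g a);
  mor_psi : forall a1 a2 x, f (mp_psi a1 a2 x) = mp_psi (g a1) (g a2) (f x)
}.

Definition zero3 (k : fieldType) (A B C D : lmodType k) : A -> B -> C -> D :=
  fun _ _ _ => 0.

Lemma zero3_trilinear (k : fieldType) (A B C D : lmodType k) :
  trilinear (@zero3 k A B C D).
Proof. by split=> ? ? ? ? ?; rewrite /zero3 scaler0 addr0. Qed.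

Lemma zero3_alternating (k : fieldType) (A B : lmodType k) :
  alternating3 (@zero3 k A A A B).
Proof. by []. Qed.

Lemma zero3_fundamental (k : fieldType) (A : lmodType k) (x1 x2 y1 y2 y3 : A) :
  let b := @zero3 k A A A A in
  b x1 x2 (b y1 y2 y3) =
    b (b x1 x2 y1) y2 y3 + b y1 (b x1 x2 y2) y3 + b y1 y2 (b x1 x2 y3).
Proof. by rewrite /zero3 /= !addr0. Qed.

Definition zero_threeLie (k : fieldType) (V : lmodType k) : threeLie k :=
  ThreeLie (zero3_trilinear V V V V) (@zero3_alternating k V V)
    (@zero3_fundamental k V).

Lemma zero_is_matched_pair (k : fieldType) (V W : lmodType k) :
  @is_matched_pair k (zero_threeLie V) (zero_threeLie W)
    (@zero3 k V V W W) (@zero3 k W W V V).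
Proof.
by split; try exact: zero3_trilinear; move=> *;
  rewrite /= /zero3 ?oppr0 ?addr0 ?oppr0.
Qed.

Definition zero_matchedPair (k : fieldType) (V W : lmodType k) : matchedPair k :=
  MatchedPair (zero_is_matched_pair V W).

Record is_mp_repr (k : fieldType) (M : matchedPair k) (V W : lmodType k)
    (rhoV : mp_g M -> mp_g M -> V -> V) (psiV : mp_h M -> mp_h M -> V -> V)
    (rhoW : mp_g M -> mp_g M -> W -> W) (psiW : mp_h M -> mp_h M -> W -> W)
    (alpha : V -> mp_g M -> mp_h M -> W)
    (beta : W -> mp_h M -> mp_g M -> V) : Prop := {
  mpr_rhoV : is_repr rhoV;
  mpr_psiV : is_repr psiV;
  mpr_rhoW : is_repr rhoW;
  mpr_psiW : is_repr psiW;
  mpr_alpha : trilinear alpha;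
  mpr_beta : trilinear beta;
  mpr_R1 : forall a1 a2 x1 x2 v,
    psiV a1 a2 (rhoV x1 x2 v) =
      rhoV (mp_psi a1 a2 x1) x2 v + rhoV x1 (mp_psi a1 a2 x2) v
      + rhoV x1 x2 (psiV a1 a2 v);
  mpr_R2 : forall a1 a2 x1 x2 x3 w1 w2,
    let B x := beta w1 a2 x - beta w2 a1 x in
    B (br x1 x2 x3) =
      rhoV x2 x3 (B x1) + rhoV x3 x1 (B x2) + rhoV x1 x2 (B x3);
  mpr_R3 : forall a1 a2 x1 x2 v,
    rhoV x1 (mp_psi a1 a2 x2) v = psiV (mp_rho x1 x2 a2) a1 v;
  mpr_R4 : forall a1 a2 x1 x2 v,
    rhoV x1 x2 (psiV a1 a2 v) = psiV (mp_rho x1 x2 a1) a2 v;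
  mpr_R5 : forall a1 a2 x1 x2 x3 v1 v2 v3 w1 w2,
    rhoV x1 x2 (beta w1 a2 x3 - beta w2 a1 x3) =
      beta (rhoW x2 x3 w2 + (alpha v2 x3 a2 - alpha v3 x2 a2)) a1 x1
      - beta w1 (mp_rho x2 x3 a2) x1
      - beta (rhoW x1 x3 w2 + (alpha v1 x3 a2 - alpha v3 x1 a2)) a1 x2
      + beta w1 (mp_rho x1 x3 a2) x2
      + beta (rhoW x1 x2 w1 + (alpha v1 x2 a1 - alpha v2 x1 a1)) a2 x3
      - beta w2 (mp_rho x1 x2 a1) x3;
  mpr_R6 : forall a1 a2 x1 x2 v,
    rhoV x1 x2 (psiV a1 a2 v) =
      psiV a1 a2 (rhoV x1 x2 v) + psiV (mp_rho x1 x2 a1) a2 v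
      + psiV a1 (mp_rho x1 x2 a2) v;
  mpr_R7 : forall a1 a2 x1 x2 x3 v2 v3 w1 w2,
    rhoV x2 x3 (beta w1 a2 x1 - beta w2 a1 x1) =
      (beta w1 a2 (br x1 x2 x3) - beta w2 a1 (br x1 x2 x3))
      - beta w2 (mp_rho x2 x3 a1) x1 + beta w1 (mp_rho x2 x3 a2) x1
      + beta (rhoW x2 x3 w1 + (alpha v2 x3 a1 - alpha v3 x2 a1)) a2 x1
      - beta (rhoW x2 x3 w2 + (alpha v2 x3 a2 - alpha v3 x2 a2)) a1 x1;
  mpr_R8 : forall a1 a2 x1 x2 v,
    rhoV (mp_psi a1 a2 x1) x2 v = psiV a1 a2 (rhoV x1 x2 v);
  mpr_R9 : forall a1 a2 x1 x2 w,
    rhoW x1 x2 (psiW a1 a2 w) =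
      psiW (mp_rho x1 x2 a1) a2 w + psiW a1 (mp_rho x1 x2 a2) w
      + psiW a1 a2 (rhoW x1 x2 w);
  mpr_R10 : forall x1 x2 a1 a2 a3 v1 v2,
    let A a := alpha v1 x2 a - alpha v2 x1 a in
    A (br a1 a2 a3) =
      psiW a2 a3 (A a1) + psiW a3 a1 (A a2) + psiW a1 a2 (A a3);
  mpr_R11 : forall a1 a2 x1 x2 w,
    psiW a1 (mp_rho x1 x2 a2) w = rhoW (mp_psi a1 a2 x2) x1 w;
  mpr_R12 : forall a1 a2 x1 x2 w,
    psiW a1 a2 (rhoW x1 x2 w) = rhoW (mp_psi a1 a2 x1) x2 w;
  mpr_R13 : forall x1 x2 a1 a2 a3 v1 v2 w1 w2 w3,
    psiW a1 a2 (alpha v1 x2 a3 - alpha v2 x1 a3) =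
      alpha (psiV a2 a3 v2 + (beta w2 a3 x2 - beta w3 a2 x2)) x1 a1
      - alpha v1 (mp_psi a2 a3 x2) a1
      - alpha (psiV a1 a3 v2 + (beta w1 a3 x2 - beta w3 a1 x2)) x1 a2
      + alpha v1 (mp_psi a1 a3 x2) a2
      + alpha (psiV a1 a2 v1 + (beta w1 a2 x1 - beta w2 a1 x1)) x2 a3
      - alpha v2 (mp_psi a1 a2 x1) a3;
  mpr_R14 : forall a1 a2 x1 x2 w,
    psiW a1 a2 (rhoW x1 x2 w) =
      rhoW x1 x2 (psiW a1 a2 w) + rhoW (mp_psi a1 a2 x1) x2 w
      + rhoW x1 (mp_psi a1 a2 x2) w;
  mpr_R15 : forall x1 x2 a1 a2 a3 v1 v2 w2 w3,
    psiW a2 a3 (alpha v1 x2 a1 - alpha v2 x1 a1) =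
      (alpha v1 x2 (br a1 a2 a3) - alpha v2 x1 (br a1 a2 a3))
      - alpha v2 (mp_psi a2 a3 x1) a1 + alpha v1 (mp_psi a2 a3 x2) a1
      + alpha (psiV a2 a3 v1 + (beta w2 a3 x1 - beta w3 a2 x1)) x2 a1
      - alpha (psiV a2 a3 v2 + (beta w2 a3 x2 - beta w3 a2 x2)) x1 a1;
  mpr_R16 : forall a1 a2 x1 x2 w,
    psiW (mp_rho x1 x2 a1) a2 w = rhoW x1 x2 (psiW a1 a2 w)
}.

Record mpRepr (k : fieldType) (M : matchedPair k) (V W : lmodType k) := MpRepr {
  rhoV : mp_g M -> mp_g M -> V -> V;
  psiV : mp_h M -> mp_h M -> V -> V;
  rhoW : mp_g M -> mp_g M -> W -> W;
  psiW : mp_h M -> mp_h M -> W -> W;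
  alpha : V -> mp_g M -> mp_h M -> W;
  beta : W -> mp_h M -> mp_g M -> V;
  mpReprP : is_mp_repr rhoV psiV rhoW psiW alpha beta
}.

Definition short_exact (k : fieldType) (A B C : lmodType k)
    (i : {linear A -> B}) (j : {linear B -> C}) : Prop :=
  [/\ injective i, forall b, j b = 0 <-> exists a, i a = b
    & forall c, exists b, j b = c].

Record extension (k : fieldType) (M : matchedPair k) (V W : lmodType k) :=
    Extension {
  ext_mp :> matchedPair k;
  ext_i1 : {linear V -> mp_g ext_mp};
  ext_i2 : {linear W -> mp_h ext_mp};
  ext_j1 : {linear mp_g ext_mp -> mp_g M};
  ext_j2 : {linear mp_h ext_mp -> mp_h M};
  ext_i_mor : is_mp_morphism (M := zero_matchedPair V W) ext_i1 ext_i2;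
  ext_j_mor : is_mp_morphism ext_j1 ext_j2;
  ext_exact1 : short_exact ext_i1 ext_j1;
  ext_exact2 : short_exact ext_i2 ext_j2
}.

Definition is_section (k : fieldType) (M : matchedPair k) (V W : lmodType k)
    (E : extension M V W) (s1 : {linear mp_g M -> mp_g E})
    (s2 : {linear mp_h M -> mp_h E}) : Prop :=
  (forall x, ext_j1 E (s1 x) = x) /\ (forall a, ext_j2 E (s2 a) = a).

(* V and W are identified with their images under ext_i1 and ext_i2. *)
Record induces (k : fieldType) (M : matchedPair k) (V W : lmodType k)
    (E : extension M V W) (s1 : {linear mp_g M -> mp_g E})
    (s2 : {linear mp_h M -> mp_h E}) (R : mpRepr M V W) : Prop := {
  ind_rhoV : forall x1 x2 v,
    ext_i1 E (rhoV R x1 x2 v) = br (s1 x1) (s1 x2) (ext_i1 E v);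
  ind_rhoW : forall x1 x2 w,
    ext_i2 E (rhoW R x1 x2 w) = mp_rho (s1 x1) (s1 x2) (ext_i2 E w);
  ind_psiV : forall a1 a2 v,
    ext_i1 E (psiV R a1 a2 v) = mp_psi (s2 a1) (s2 a2) (ext_i1 E v);
  ind_psiW : forall a1 a2 w,
    ext_i2 E (psiW R a1 a2 w) = br (s2 a1) (s2 a2) (ext_i2 E w);
  ind_alpha : forall v x a,
    ext_i2 E (alpha R v x a) = mp_rho (ext_i1 E v) (s1 x) (s2 a);
  ind_beta : forall w a x,
    ext_i1 E (beta R w a x) = mp_psi (ext_i2 E w) (s2 a) (s1 x)
}.

(* Independence of the section: the six right-hand sides of [induces] depend
   only on the elements of g and h, not on the chosen preimages.  The preimages
   vary independently of each other; letting only the linear section vary would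
   impose nothing in small dimensions (e.g. nothing on [v1, v2, s1 x] when
   dim g = 1), where extensions that are not abelian would then slip in. *)
Record section_independent (k : fieldType) (M : matchedPair k)
    (V W : lmodType k) (E : extension M V W) : Prop := {
  indep_rhoV : forall X1 X2 Y1 Y2 v,
    ext_j1 E X1 = ext_j1 E Y1 -> ext_j1 E X2 = ext_j1 E Y2 ->
    br X1 X2 (ext_i1 E v) = br Y1 Y2 (ext_i1 E v);
  indep_rhoW : forall X1 X2 Y1 Y2 w,
    ext_j1 E X1 = ext_j1 E Y1 -> ext_j1 E X2 = ext_j1 E Y2 ->
    mp_rho X1 X2 (ext_i2 E w) = mp_rho Y1 Y2 (ext_i2 E w);
  indep_psiV : forall A1 A2 B1 B2 v,
    ext_j2 E A1 = ext_j2 E B1 -> ext_j2 E A2 = ext_j2 E B2 ->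
    mp_psi A1 A2 (ext_i1 E v) = mp_psi B1 B2 (ext_i1 E v);
  indep_psiW : forall A1 A2 B1 B2 w,
    ext_j2 E A1 = ext_j2 E B1 -> ext_j2 E A2 = ext_j2 E B2 ->
    br A1 A2 (ext_i2 E w) = br B1 B2 (ext_i2 E w);
  indep_alpha : forall v X Y A B,
    ext_j1 E X = ext_j1 E Y -> ext_j2 E A = ext_j2 E B ->
    mp_rho (ext_i1 E v) X A = mp_rho (ext_i1 E v) Y B;
  indep_beta : forall w A B X Y,
    ext_j2 E A = ext_j2 E B -> ext_j1 E X = ext_j1 E Y ->
    mp_psi (ext_i2 E w) A X = mp_psi (ext_i2 E w) B Y
}.

(* "Some section" is the same as "every section" here: a section exists because
   k is a field, and the formulas do not depend on it. *)
Definition has_induced_repr (k : fieldType) (M : matchedPair k)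
    (V W : lmodType k) (R : mpRepr M V W) (E : extension M V W) : Prop :=
  section_independent E /\
  exists (s1 : {linear mp_g M -> mp_g E}) (s2 : {linear mp_h M -> mp_h E}),
    is_section s1 s2 /\ induces s1 s2 R.

Definition isomorphic_ext (k : fieldType) (M : matchedPair k)
    (V W : lmodType k) (E E' : extension M V W) : Prop :=
  exists (f : {linear mp_g E -> mp_g E'}) (g : {linear mp_h E -> mp_h E'}),
    [/\ is_mp_morphism f g, bijective f, bijective g,
        (forall v, f (ext_i1 E v) = ext_i1 E' v) /\
        (forall w, g (ext_i2 E w) = ext_i2 E' w)
      & (forall X, ext_j1 E' (f X) = ext_j1 E X) /\
        (forall A, ext_j2 E' (g A) = ext_j2 E A)].

(* The set of classes of an equivalence relation. *)
Definition quotient_set (T : Type) (r : T -> T -> Prop) : Type :=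
  {C : T -> Prop | exists x, C = r x}.

Definition Ext (k : fieldType) (M : matchedPair k) (V W : lmodType k)
    (R : mpRepr M V W) : Type :=
  quotient_set (fun E E' : {E : extension M V W | has_induced_repr R E} =>
    isomorphic_ext (sval E) (sval E')).

Record cochain2 (k : fieldType) (M : matchedPair k) (V W : lmodType k) :=
    Cochain2 {
  c_omega : mp_g M -> mp_g M -> mp_g M -> V;
  c_theta : mp_h M -> mp_h M -> mp_h M -> W;
  c_nu : mp_g M -> mp_g M -> mp_h M -> W;
  c_phi : mp_h M -> mp_h M -> mp_g M -> V
}.

Record is_cochain2 (k : fieldType) (M : matchedPair k) (V W : lmodType k)
    (c : cochain2 M V W) : Prop := {
  omega_trilinear : trilinear (c_omega c);
  omega_alternating : alternating3 (c_omega c);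
  theta_trilinear : trilinear (c_theta c);
  theta_alternating : alternating3 (c_theta c);
  nu_trilinear : trilinear (c_nu c);
  nu_alternating : alternating2 (c_nu c);
  phi_trilinear : trilinear (c_phi c);
  phi_alternating : alternating2 (c_phi c)
}.

Definition cocycle3 (k : fieldType) (g : threeLie k) (V : lmodType k)
    (rho : g -> g -> V -> V) (om : g -> g -> g -> V) : Prop :=
  forall x1 x2 x3 x4 x5,
    rho x4 x5 (om x1 x2 x3) + rho x5 x3 (om x1 x2 x4)
    + rho x3 x4 (om x1 x2 x5) + om (br x1 x2 x3) x4 x5
    + om x3 (br x1 x2 x4) x5 + om x3 x4 (br x1 x2 x5) =
      rho x1 x2 (om x3 x4 x5) + om x1 x2 (br x3 x4 x5).

Record is_cocycle2 (k : fieldType) (M : matchedPair k) (V W : lmodType k)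
    (R : mpRepr M V W) (c : cochain2 M V W) : Prop := {
  coc_cochain : is_cochain2 c;
  coc_Z1 : cocycle3 (rhoV R) (c_omega c);
  coc_Z2 : cocycle3 (psiW R) (c_theta c);
  coc_Z3 : forall x1 x2 a1 a2 a3,
    rhoW R x1 x2 (c_theta c a1 a2 a3) + c_nu c x1 x2 (br a1 a2 a3) =
      psiW R a2 a3 (c_nu c x1 x2 a1) + psiW R a3 a1 (c_nu c x1 x2 a2)
      + psiW R a1 a2 (c_nu c x1 x2 a3)
      + c_theta c (mp_rho x1 x2 a1) a2 a3 + c_theta c a1 (mp_rho x1 x2 a2) a3
      + c_theta c a1 a2 (mp_rho x1 x2 a3);
  coc_Z4 : forall a1 a2 x1 x2 x3,
    psiV R a1 a2 (c_omega c x1 x2 x3) + c_phi c a1 a2 (br x1 x2 x3) =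
      rhoV R x2 x3 (c_phi c a1 a2 x1) + rhoV R x3 x1 (c_phi c a1 a2 x2)
      + rhoV R x1 x2 (c_phi c a1 a2 x3)
      + c_omega c (mp_psi a1 a2 x1) x2 x3 + c_omega c x1 (mp_psi a1 a2 x2) x3
      + c_omega c x1 x2 (mp_psi a1 a2 x3);
  coc_Z5 : forall a1 a2 x1 x2 x3,
    beta R (c_nu c x1 x2 a1) a2 x3 + c_phi c (mp_rho x1 x2 a1) a2 x3 =
      beta R (c_nu c x1 x3 a2) a1 x2 + c_phi c (mp_rho x1 x3 a2) a1 x2
      - beta R (c_nu c x2 x3 a2) a1 x1 - c_phi c (mp_rho x2 x3 a2) a1 x1
      + rhoV R x1 x2 (c_phi c a1 a2 x3) + c_omega c x1 x2 (mp_psi a1 a2 x3);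
  coc_Z6 : forall x1 x2 a1 a2 a3,
    alpha R (c_phi c a1 a2 x1) x2 a3 + c_nu c (mp_psi a1 a2 x1) x2 a3 =
      alpha R (c_phi c a1 a3 x2) x1 a2 + c_nu c (mp_psi a1 a3 x2) x1 a2
      - alpha R (c_phi c a2 a3 x2) x1 a1 - c_nu c (mp_psi a2 a3 x2) x1 a1
      + psiW R a1 a2 (c_nu c x1 x2 a3) + c_theta c a1 a2 (mp_rho x1 x2 a3);
  coc_Z7 : forall a1 a2 x1 x2 x3,
    c_omega c (mp_psi a1 a2 x1) x2 x3 + rhoV R x2 x3 (c_phi c a1 a2 x1) =
      psiV R a1 a2 (c_omega c x1 x2 x3) + c_phi c a1 a2 (br x1 x2 x3)
      + c_phi c (mp_rho x2 x3 a1) a2 x1 + beta R (c_nu c x2 x3 a1) a2 x1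
      + c_phi c a1 (mp_rho x2 x3 a2) x1 - beta R (c_nu c x2 x3 a2) a1 x1;
  coc_Z8 : forall x1 x2 a1 a2 a3,
    c_theta c (mp_rho x1 x2 a1) a2 a3 + psiW R a2 a3 (c_nu c x1 x2 a1) =
      rhoW R x1 x2 (c_theta c a1 a2 a3) + c_nu c x1 x2 (br a1 a2 a3)
      + c_nu c (mp_psi a2 a3 x1) x2 a1 + alpha R (c_phi c a2 a3 x1) x2 a1
      + c_nu c x1 (mp_psi a2 a3 x2) a1 - alpha R (c_phi c a2 a3 x2) x1 a1
}.

Definition D1 (k : fieldType) (M : matchedPair k) (V W : lmodType k)
    (R : mpRepr M V W) (N1 : {linear mp_g M -> V})
    (N2 : {linear mp_h M -> W}) : cochain2 M V W := {|
  c_omega x1 x2 x3 :=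
    rhoV R x2 x3 (N1 x1) + rhoV R x3 x1 (N1 x2) + rhoV R x1 x2 (N1 x3)
    - N1 (br x1 x2 x3);
  c_theta a1 a2 a3 :=
    psiW R a2 a3 (N2 a1) + psiW R a3 a1 (N2 a2) + psiW R a1 a2 (N2 a3)
    - N2 (br a1 a2 a3);
  c_nu x1 x2 a :=
    rhoW R x1 x2 (N2 a) - N2 (mp_rho x1 x2 a)
    + alpha R (N1 x1) x2 a - alpha R (N1 x2) x1 a;
  c_phi a1 a2 x :=
    psiV R a1 a2 (N1 x) - N1 (mp_psi a1 a2 x)
    + beta R (N2 a1) a2 x - beta R (N2 a2) a1 x
|}.

Definition sub_cochain2 (k : fieldType) (M : matchedPair k) (V W : lmodType k)
    (c c' : cochain2 M V W) : cochain2 M V W := {|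
  c_omega x1 x2 x3 := c_omega c x1 x2 x3 - c_omega c' x1 x2 x3;
  c_theta a1 a2 a3 := c_theta c a1 a2 a3 - c_theta c' a1 a2 a3;
  c_nu x1 x2 a := c_nu c x1 x2 a - c_nu c' x1 x2 a;
  c_phi a1 a2 x := c_phi c a1 a2 x - c_phi c' a1 a2 x
|}.

Definition cohomologous (k : fieldType) (M : matchedPair k) (V W : lmodType k)
    (R : mpRepr M V W) (c c' : cochain2 M V W) : Prop :=
  exists N1 N2, sub_cochain2 c c' = D1 R N1 N2.

Definition H2 (k : fieldType) (M : matchedPair k) (V W : lmodType k)
    (R : mpRepr M V W) : Type :=
  quotient_set (fun c c' : {c : cochain2 M V W | is_cocycle2 R c} =>
    cohomologous R (sval c) (sval c')).

(* Main.v *)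
(* Once linear sections are chosen, an extension has underlying spaces g + V
   and h + W, and its four operations are those of the semidirect product plus
   a 2-cochain (omega, theta, nu, phi).  Evaluated on arbitrary elements, the
   fundamental identity and each of M1-M6 for such operations differ from the
   representation axioms R1-R16 exactly by one of the equations Z1-Z8 in the
   components along g and h, so cocycles are the same as extensions with
   sections.  Moving the sections by (N1, N2) adds D1(N1, N2) to the cochain,
   and two extensions are isomorphic iff they have the same cochain for some
   choice of sections.  All of this is symmetric under exchanging g and h, so
   M4-M6 follow from M1-M3. *)
Require Import Defs.
From HB Require Import structures.
From mathcomp Require Import all_boot all_algebra.
From mathcomp Require Import boolp.
Set Implicit Arguments.
Unset Strict Implicit.
Unset Printing Implicit Defensive.
Import GRing.Theory.
Local Open Scope ring_scope.

(** * Identities in abelian groups *)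

(* [zmod] decides equality of Z-linear combinations of atoms by comparing
   coefficients. *)
Inductive zexpr := ZVar of nat | ZZero | ZAdd of zexpr & zexpr | ZOpp of zexpr.

Fixpoint zeval (V : zmodType) (env : seq V) (e : zexpr) : V :=
  match e with
  | ZVar i => env`_i
  | ZZero => 0
  | ZAdd e1 e2 => zeval env e1 + zeval env e2
  | ZOpp e1 => - zeval env e1
  end.

Fixpoint zcoef (i : nat) (e : zexpr) : int :=
  match e with
  | ZVar j => (i == j)%:Z
  | ZZero => 0
  | ZAdd e1 e2 => zcoef i e1 + zcoef i e2
  | ZOpp e1 => - zcoef i e1
  end.

Lemma zevalE (V : zmodType) (env : seq V) (e : zexpr) :
  zeval env e = \sum_(i < size env) env`_i *~ zcoef i e.
Proof.
elim: e => [j||e1 IH1 e2 IH2|e1 IH1] /=; rewrite ?IH1 ?IH2.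
- have [ltj|lej] := ltnP j (size env).
    rewrite (bigD1 (Ordinal ltj)) //= eqxx big1 ?addr0 // => i.
    by rewrite -val_eqE /= => /negPf ->.
  (* A variable past the end of [env] evaluates to the default 0, and no index of the sum picks it
     up. *)
  rewrite nth_default // big1 // => i _.
  by rewrite (ltn_eqF (leq_trans (ltn_ord i) lej)).
- by rewrite big1.
- by rewrite -big_split /=; apply: eq_bigr => i _; rewrite mulrzDr.
- by rewrite -sumrN; apply: eq_bigr => i _; rewrite mulrNz.
Qed.

(** Both sides are integer combinations of the entries of [env], so a finite comparison of
    coefficients suffices, and it can be computed. *)
Lemma zeval_eq (V : zmodType) (env : seq V) (e1 e2 : zexpr) :
  all (fun i => zcoef i e1 == zcoef i e2) (iota 0 (size env)) ->
  zeval env e1 = zeval env e2.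
Proof.
move/allP => eq12; rewrite !zevalE; apply: eq_bigr => i _.
by rewrite (eqP (eq12 _ _)) // mem_iota ltn_ord.
Qed.

Ltac zindex x env :=
  lazymatch env with
  | x :: _ => constr:(0%N)
  | _ :: ?env' => let n := zindex x env' in constr:(S n)
  end.

(** The two identical patterns encode a membership test: [zindex] fails when the atom is new, and
    backtracking then adds it to [env]. *)
Ltac zatoms e env :=
  lazymatch e with
  | 0 => env
  | (?a + ?b)%R => let env' := zatoms a env in zatoms b env'
  | (- ?a)%R => zatoms a env
  | _ => match env with
         | _ => let _ := zindex e env in env
         | _ => constr:(e :: env)
         end
  end.

Ltac zreify env e :=
  lazymatch e with
  | 0 => constr:(ZZero)
  | (?a + ?b)%R =>
      let ra := zreify env a in let rb := zreify env b in constr:(ZAdd ra rb)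
  | (- ?a)%R => let ra := zreify env a in constr:(ZOpp ra)
  | _ => let n := zindex e env in constr:(ZVar n)
  end.

Ltac zmod :=
  lazymatch goal with |- @eq ?T ?x ?y =>
    let env := zatoms x (@nil T) in
    let env := zatoms y env in
    let ex := zreify env x in
    let ey := zreify env y in
    apply: (@zeval_eq _ env ex ey); vm_compute; reflexivity
  end.

(** Applied backwards by [use]: a known equation is added crosswise to the goal. Once all relevant
    relations are added, the goal holds in the free abelian group on its atoms and [zmod] closes
    it. *)
Lemma lin_comb (V : zmodType) (a b x y : V) : a = b -> x + b = y + a -> x = y.
Proof. by move=> ->; apply: addIr. Qed.

(** The hypothesis says [x - y = z - t], so one difference vanishes exactly when the other does. The
    variant below has [x - y = t - z]. *)
Lemma eq_iff_transfer (V : zmodType) (x y z t : V) :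
  x + t = y + z -> x = y <-> z = t.
Proof.
by move=> e; split=> [xy|zt]; [apply: (addrI y); rewrite -e xy|
  apply: (addIr t); rewrite e zt].
Qed.

Lemma eq_iff_transferN (V : zmodType) (x y z t : V) :
  x + z = y + t -> x = y <-> z = t.
Proof.
by move=> e; have [xy yx] := eq_iff_transfer e; split=> [/xy|/esym/yx].
Qed.

(** * Trilinear maps *)

Section Trilinear.
Variables (k : fieldType) (A B C D : lmodType k) (f : A -> B -> C -> D).
Hypothesis f_lin : trilinear f.

Lemma trilinearD :
  (forall a a' b c, f (a + a') b c = f a b c + f a' b c)
  * (forall a b b' c, f a (b + b') c = f a b c + f a b' c)
  * (forall a b c c', f a b (c + c') = f a b c + f a b c').
Proof.
case: f_lin => lin1 lin2 lin3; do !split.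
- by move=> a a' b c; have := lin1 b c 1 a a'; rewrite !scale1r.
- by move=> a b b' c; have := lin2 a c 1 b b'; rewrite !scale1r.
- by move=> a b c c'; have := lin3 a b 1 c c'; rewrite !scale1r.
Qed.

Lemma trilinear0 :
  (forall b c, f 0 b c = 0) * (forall a c, f a 0 c = 0)
  * (forall a b, f a b 0 = 0).
Proof.
do !split.
- by move=> b c; apply: (addrI (f 0 b c)); rewrite -trilinearD.1.1 !addr0.
- by move=> a c; apply: (addrI (f a 0 c)); rewrite -trilinearD.1.2 !addr0.
- by move=> a b; apply: (addrI (f a b 0)); rewrite -trilinearD.2 !addr0.
Qed.

Lemma trilinearN :
  (forall a b c, f (- a) b c = - f a b c)
  * (forall a b c, f a (- b) c = - f a b c)
  * (forall a b c, f a b (- c) = - f a b c).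
Proof.
do !split; move=> a b c; apply/eqP; rewrite -addr_eq0.
- by rewrite -trilinearD.1.1 addNr trilinear0.
- by rewrite -trilinearD.1.2 addNr trilinear0.
- by rewrite -trilinearD.2 addNr trilinear0.
Qed.

Lemma trilinearE :
  (forall a a' b c, f (a + a') b c = f a b c + f a' b c)
  * (forall a b b' c, f a (b + b') c = f a b c + f a b' c)
  * (forall a b c c', f a b (c + c') = f a b c + f a b c')
  * (forall a b c, f (- a) b c = - f a b c)
  * (forall a b c, f a (- b) c = - f a b c)
  * (forall a b c, f a b (- c) = - f a b c)
  * (forall b c, f 0 b c = 0) * (forall a c, f a 0 c = 0)
  * (forall a b, f a b 0 = 0).
Proof. by do !split; move=> *; rewrite ?trilinearD ?trilinearN ?trilinear0. Qed.

Lemma trilinearZ l a b c :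
  (f (l *: a) b c = l *: f a b c) * (f a (l *: b) c = l *: f a b c)
  * (f a b (l *: c) = l *: f a b c).
Proof.
case: f_lin => lin1 lin2 lin3; do !split.
- by have := lin1 b c l a 0; rewrite trilinear0 !addr0.
- by have := lin2 a c l b 0; rewrite trilinear0 !addr0.
- by have := lin3 a b l c 0; rewrite trilinear0 !addr0.
Qed.

End Trilinear.

(** Polarisation: expand [f] with [a + b] in both alternating slots and drop the diagonal terms. *)
Lemma alternating2C (k : fieldType) (A B C : lmodType k)
    (f : A -> A -> B -> C) :
  trilinear f -> alternating2 f -> forall a b c, f a b c = - f b a c.
Proof.
move=> lin alt a b c; apply/eqP; rewrite -addr_eq0; apply/eqP.
by rewrite -[RHS](alt (a + b) c) !(trilinearE lin) !alt; zmod.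
Qed.

Lemma alternating3C (k : fieldType) (A B : lmodType k) (f : A -> A -> A -> B) :
  trilinear f -> alternating3 f ->
  forall a b c, f a b c = - f b a c /\ f a b c = - f a c b.
Proof.
move=> lin alt a b c.
have alt12 x y : f x x y = 0 by case: (alt x y).
have alt23 x y : f y x x = 0 by case: (alt x y).
split; apply/eqP; rewrite -addr_eq0; apply/eqP.
  by rewrite -[RHS](alt12 (a + b) c) !(trilinearE lin) !alt12; zmod.
by rewrite -[RHS](alt23 (b + c) a) !(trilinearE lin) !alt23; zmod.
Qed.

Lemma alternating3_cycle (k : fieldType) (A B : lmodType k)
    (f : A -> A -> A -> B) :
  trilinear f -> alternating3 f -> forall a b c, f a b c = f b c a.
Proof.
move=> lin alt a b c; have [-> _] := alternating3C lin alt a b c.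
by have [_ ->] := alternating3C lin alt b a c; rewrite opprK.
Qed.

(** * Twisted operations *)

Section Twist.
Variables (k : fieldType) (g h : threeLie k) (V W : lmodType k).

(** The semidirect product bracket plus the cochain [om]. In each action term the entry from V has
    been rotated cyclically to the last slot. *)
Definition twist_br (rho : g -> g -> V -> V) (om : g -> g -> g -> V)
    (X Y Z : g * V) : g * V :=
  (br X.1 Y.1 Z.1,
   rho Y.1 Z.1 X.2 + rho Z.1 X.1 Y.2 + rho X.1 Y.1 Z.2 + om X.1 Y.1 Z.1).

(** One formula serves both actions: with [alpha] and [nu] it extends [rho], and with g and h
    exchanged, [beta] and [phi] it extends [psi]. The minus sign makes it skew in the first two
    arguments. *)
Definition twist_act (rho : g -> g -> h -> h) (rhoW : g -> g -> W -> W)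
    (alpha : V -> g -> h -> W) (nu : g -> g -> h -> W)
    (X Y : g * V) (A : h * W) : h * W :=
  (rho X.1 Y.1 A.1,
   rhoW X.1 Y.1 A.2 + alpha X.2 Y.1 A.1 - alpha Y.2 X.1 A.1 + nu X.1 Y.1 A.1).

End Twist.

Ltac use e := apply: (lin_comb e).

Lemma pair_addE (U V : zmodType) (X Y : U * V) :
  X + Y = (X.1 + Y.1, X.2 + Y.2).
Proof. by []. Qed.

Lemma pair_oppE (U V : zmodType) (X : U * V) : - X = (- X.1, - X.2).
Proof. by []. Qed.

(** Used to discard the first component of an identity between twisted operations, where it is an
    identity of the given structure. *)
Lemma pair_eq_iff (A B : Type) (a a' : A) (b b' : B) :
  a = a' -> ((a, b) = (a', b') <-> b = b').
Proof. by move=> ->; split=> [[]|->]. Qed.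

(** In the V component, the commutator axiom of [rho] cancels the terms in [w1], [w2], [w3], and the
    bracket axiom those in [v1], [v2]. What survives involves only [om]. *)
Lemma twist_fundamental_iff (k : fieldType) (g : threeLie k) (V : lmodType k)
    (rho : g -> g -> V -> V) (om : g -> g -> g -> V) (X1 X2 Y1 Y2 Y3 : g * V) :
  is_repr rho ->
  let b := twist_br rho om in
  b X1 X2 (b Y1 Y2 Y3) =
    b (b X1 X2 Y1) Y2 Y3 + b Y1 (b X1 X2 Y2) Y3 + b Y1 Y2 (b X1 X2 Y3) <->
  rho Y2.1 Y3.1 (om X1.1 X2.1 Y1.1) + rho Y3.1 Y1.1 (om X1.1 X2.1 Y2.1)
    + rho Y1.1 Y2.1 (om X1.1 X2.1 Y3.1) + om (br X1.1 X2.1 Y1.1) Y2.1 Y3.1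
    + om Y1.1 (br X1.1 X2.1 Y2.1) Y3.1 + om Y1.1 Y2.1 (br X1.1 X2.1 Y3.1) =
  rho X1.1 X2.1 (om Y1.1 Y2.1 Y3.1) + om X1.1 X2.1 (br Y1.1 Y2.1 Y3.1).
Proof.
move: X1 X2 Y1 Y2 Y3 => [x1 v1] [x2 v2] [y1 w1] [y2 w2] [y3 w3].
case=> lin alt comm rbr; rewrite /twist_br /=.
rewrite !pair_addE /= pair_eq_iff; last exact: br_fundamental.
apply: eq_iff_transferN; rewrite !(trilinearE lin).
have skew := alternating2C lin alt.
use (comm x1 x2 y1 y2 w3); use (comm x1 x2 y2 y3 w1).
use (comm x1 x2 y3 y1 w2).
use (esym (rbr y1 y2 y3 x2 v1)); use (rbr y1 y2 y3 x1 v2).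
(* For [zmod], [rho x y] and [rho y x] are unrelated atoms, so arguments are first put in a common
   order. *)
rewrite (skew y1 x2) (skew y2 x2) (skew y3 x2) !(trilinearE lin).
rewrite (skew x2 (br _ _ _)).
zmod.
Qed.

(** * Exchanging the two algebras *)

(** M4-M6 are M1-M3 with the roles of g and h exchanged; likewise R9-R16 mirror R1-R8 below. Results
    about the g half therefore transfer to the h half. *)
Lemma swap_is_matched_pair (k : fieldType) (M : matchedPair k) :
  is_matched_pair (@mp_psi k M) (@mp_rho k M).
Proof.
by case: (mpP M) => *; split.
Qed.

Definition swap_mp (k : fieldType) (M : matchedPair k) : matchedPair k :=
  MatchedPair (swap_is_matched_pair M).

Lemma swap_is_mp_repr (k : fieldType) (M : matchedPair k) (V W : lmodType k)
    (R : mpRepr M V W) :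
  @is_mp_repr k (swap_mp M) W V (psiW R) (rhoW R) (psiV R) (rhoV R)
    (beta R) (alpha R).
Proof.
by case: (mpReprP R) => *; split=> //=.
Qed.

Definition swap_repr (k : fieldType) (M : matchedPair k) (V W : lmodType k)
    (R : mpRepr M V W) : mpRepr (swap_mp M) W V :=
  MpRepr (swap_is_mp_repr R).

Definition swap_cochain (k : fieldType) (M : matchedPair k) (V W : lmodType k)
    (c : cochain2 M V W) : cochain2 (swap_mp M) W V :=
  @Cochain2 k (swap_mp M) W V (c_theta c) (c_omega c) (c_phi c) (c_nu c).

(** * Matched pair identities for the twisted operations *)

Section TwistedMatchedPair.
Variables (k : fieldType) (M : matchedPair k) (V W : lmodType k).
Variables (R : mpRepr M V W) (c : cochain2 M V W).

Definition twisted_br := twist_br (rhoV R) (c_omega c).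
Definition twisted_rho := twist_act (@mp_rho k M) (rhoW R) (alpha R) (c_nu c).
Definition twisted_psi := twist_act (@mp_psi k M) (psiV R) (beta R) (c_phi c).

(** R1 cancels the terms in [v1], [v2], [v3] and R2 those in [w1], [w2]; the remainder is Z4. *)
Lemma twisted_M1_iff A1 A2 X1 X2 X3 :
  twisted_psi A1 A2 (twisted_br X1 X2 X3) =
    twisted_br (twisted_psi A1 A2 X1) X2 X3
    + twisted_br X1 (twisted_psi A1 A2 X2) X3
    + twisted_br X1 X2 (twisted_psi A1 A2 X3) <->
  psiV R A1.1 A2.1 (c_omega c X1.1 X2.1 X3.1)
    + c_phi c A1.1 A2.1 (br X1.1 X2.1 X3.1) =
  rhoV R X2.1 X3.1 (c_phi c A1.1 A2.1 X1.1)
    + rhoV R X3.1 X1.1 (c_phi c A1.1 A2.1 X2.1)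
    + rhoV R X1.1 X2.1 (c_phi c A1.1 A2.1 X3.1)
    + c_omega c (mp_psi A1.1 A2.1 X1.1) X2.1 X3.1
    + c_omega c X1.1 (mp_psi A1.1 A2.1 X2.1) X3.1
    + c_omega c X1.1 X2.1 (mp_psi A1.1 A2.1 X3.1).
Proof.
move: A1 A2 X1 X2 X3 => [a1 w1] [a2 w2] [x1 v1] [x2 v2] [x3 v3].
rewrite /twisted_br /twisted_psi /twist_br /twist_act !pair_addE /= pair_eq_iff;
  last exact: (mp_M1 (mpP M)).
have linV := repr_trilinear (mpr_rhoV (mpReprP R)).
have linV' := repr_trilinear (mpr_psiV (mpReprP R)).
apply: eq_iff_transfer; rewrite !(trilinearE linV) !(trilinearE linV').
have R1 := mpr_R1 (mpReprP R) a1 a2.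
use (R1 x2 x3 v1); use (R1 x3 x1 v2); use (R1 x1 x2 v3).
use (mpr_R2 (mpReprP R) a1 a2 x1 x2 x3 w1 w2); rewrite !(trilinearE linV).
zmod.
Qed.

(** R3 and R4 cancel the terms where [psiV] or [rhoV] acts on [v1], [v2], [v3]; R5 cancels those
    through [beta] that do not contain [nu]. The remainder is Z5. *)
Lemma twisted_M2_iff A1 A2 X1 X2 X3 :
  - twisted_psi (twisted_rho X1 X2 A1) A2 X3 =
    - twisted_psi (twisted_rho X1 X3 A2) A1 X2
    + twisted_psi (twisted_rho X2 X3 A2) A1 X1
    - twisted_br X1 X2 (twisted_psi A1 A2 X3) <->
  beta R (c_nu c X1.1 X2.1 A1.1) A2.1 X3.1
    + c_phi c (mp_rho X1.1 X2.1 A1.1) A2.1 X3.1 =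
  beta R (c_nu c X1.1 X3.1 A2.1) A1.1 X2.1
    + c_phi c (mp_rho X1.1 X3.1 A2.1) A1.1 X2.1
    - beta R (c_nu c X2.1 X3.1 A2.1) A1.1 X1.1
    - c_phi c (mp_rho X2.1 X3.1 A2.1) A1.1 X1.1
    + rhoV R X1.1 X2.1 (c_phi c A1.1 A2.1 X3.1)
    + c_omega c X1.1 X2.1 (mp_psi A1.1 A2.1 X3.1).
Proof.
move: A1 A2 X1 X2 X3 => [a1 w1] [a2 w2] [x1 v1] [x2 v2] [x3 v3].
rewrite /twisted_br /twisted_psi /twisted_rho /twist_br /twist_act.
rewrite !pair_oppE !pair_addE /=.
rewrite pair_eq_iff; last exact: (mp_M2 (mpP M)).
have linV := repr_trilinear (mpr_rhoV (mpReprP R)).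
have linV' := repr_trilinear (mpr_psiV (mpReprP R)).
have linb := mpr_beta (mpReprP R).
have skew := alternating2C linV (repr_alternating (mpr_rhoV (mpReprP R))).
apply: eq_iff_transferN.
rewrite !(trilinearE linV, trilinearE linV', trilinearE linb).
use (mpr_R4 (mpReprP R) a1 a2 x1 x2 v3).
use (mpr_R3 (mpReprP R) a1 a2 x2 x3 v1).
use (esym (mpr_R3 (mpReprP R) a1 a2 x1 x3 v2)).
use (mpr_R5 (mpReprP R) a1 a2 x1 x2 x3 v1 v2 v3 w1 w2).
rewrite !(trilinearE linV, trilinearE linV', trilinearE linb).
rewrite (skew (mp_psi a1 a2 x3)).
zmod.
Qed.

(** R6 takes care of [v1], R8 of [v2] and [v3] under the actions, and R7 of the terms through [beta]
    without [nu]. The remainder is Z7. *)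
Lemma twisted_M3_iff A1 A2 X1 X2 X3 :
  twisted_br (twisted_psi A1 A2 X1) X2 X3 =
    twisted_psi A1 A2 (twisted_br X1 X2 X3)
    + twisted_psi (twisted_rho X2 X3 A1) A2 X1
    + twisted_psi A1 (twisted_rho X2 X3 A2) X1 <->
  c_omega c (mp_psi A1.1 A2.1 X1.1) X2.1 X3.1
    + rhoV R X2.1 X3.1 (c_phi c A1.1 A2.1 X1.1) =
  psiV R A1.1 A2.1 (c_omega c X1.1 X2.1 X3.1)
    + c_phi c A1.1 A2.1 (br X1.1 X2.1 X3.1)
    + c_phi c (mp_rho X2.1 X3.1 A1.1) A2.1 X1.1
    + beta R (c_nu c X2.1 X3.1 A1.1) A2.1 X1.1
    + c_phi c A1.1 (mp_rho X2.1 X3.1 A2.1) X1.1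
    - beta R (c_nu c X2.1 X3.1 A2.1) A1.1 X1.1.
Proof.
move: A1 A2 X1 X2 X3 => [a1 w1] [a2 w2] [x1 v1] [x2 v2] [x3 v3].
rewrite /twisted_br /twisted_psi /twisted_rho /twist_br /twist_act.
rewrite !pair_addE /=.
rewrite pair_eq_iff; last exact: (mp_M3 (mpP M)).
have linV := repr_trilinear (mpr_rhoV (mpReprP R)).
have linV' := repr_trilinear (mpr_psiV (mpReprP R)).
have linb := mpr_beta (mpReprP R).
have skew := alternating2C linV (repr_alternating (mpr_rhoV (mpReprP R))).
apply: eq_iff_transfer.
rewrite !(trilinearE linV, trilinearE linV', trilinearE linb).
use (mpr_R6 (mpReprP R) a1 a2 x2 x3 v1).
use (mpr_R8 (mpReprP R) a1 a2 x1 x2 v3).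
use (esym (mpr_R8 (mpReprP R) a1 a2 x1 x3 v2)).
use (mpr_R7 (mpReprP R) a1 a2 x1 x2 x3 v2 v3 w1 w2).
rewrite !(trilinearE linV, trilinearE linV', trilinearE linb).
rewrite (skew (mp_psi a1 a2 x1) x3) (skew x1 x3) (trilinearE linV').
zmod.
Qed.

End TwistedMatchedPair.

(** * Multilinearity of the twisted operations and their values on V and W *)

Lemma twist_br_trilinear (k : fieldType) (g : threeLie k) (V : lmodType k)
    (rho : g -> g -> V -> V) (om : g -> g -> g -> V) :
  trilinear rho -> trilinear om -> trilinear (twist_br rho om).
Proof.
move=> lin_rho lin_om; have lin_br := @br_trilinear k g.
by split=> Y Z l X X'; rewrite /twist_br /=;
  rewrite !(trilinearE lin_rho, trilinearE lin_om, trilinearE lin_br,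
    trilinearZ lin_rho, trilinearZ lin_om, trilinearZ lin_br);
  congr pair; rewrite /= !scalerDr; zmod.
Qed.

Lemma twist_br_alternating (k : fieldType) (g : threeLie k) (V : lmodType k)
    (rho : g -> g -> V -> V) (om : g -> g -> g -> V) :
  trilinear rho -> alternating2 rho -> alternating3 om ->
  alternating3 (twist_br rho om).
Proof.
move=> lin alt_rho alt_om X Y; have skew := alternating2C lin alt_rho.
have [b1 b2 b3] := br_alternating X.1 Y.1; have [o1 o2 o3] := alt_om X.1 Y.1.
by split; rewrite /twist_br /= ?b1 ?b2 ?b3 ?o1 ?o2 ?o3 alt_rho;
  congr pair; rewrite (skew Y.1); zmod.
Qed.

Lemma twist_act_trilinear (k : fieldType) (g h : threeLie k)
    (V W : lmodType k) (rho : g -> g -> h -> h) (rhoW : g -> g -> W -> W)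
    (al : V -> g -> h -> W) (nu : g -> g -> h -> W) :
  trilinear rho -> trilinear rhoW -> trilinear al -> trilinear nu ->
  trilinear (twist_act rho rhoW al nu).
Proof.
move=> lin1 lin2 lin3 lin4.
by split=> Y Z l X X'; rewrite /twist_act /=;
  rewrite !(trilinearE lin1, trilinearE lin2, trilinearE lin3, trilinearE lin4,
    trilinearZ lin1, trilinearZ lin2, trilinearZ lin3, trilinearZ lin4);
  congr pair; rewrite /= !scalerDr ?scalerN; zmod.
Qed.

Lemma twist_act_alternating (k : fieldType) (g h : threeLie k)
    (V W : lmodType k) (rho : g -> g -> h -> h) (rhoW : g -> g -> W -> W)
    (al : V -> g -> h -> W) (nu : g -> g -> h -> W) :
  alternating2 rho -> alternating2 rhoW -> alternating2 nu ->
  alternating2 (twist_act rho rhoW al nu).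
Proof.
move=> alt1 alt2 alt3 X A; rewrite /twist_act alt1 alt2 alt3.
by congr pair; zmod.
Qed.

Lemma twist_br_inr (k : fieldType) (g : threeLie k) (V : lmodType k)
    (rho : g -> g -> V -> V) (om : g -> g -> g -> V) (X Y : g * V) (v : V) :
  trilinear rho -> trilinear om ->
  twist_br rho om X Y (0, v) = (0, rho X.1 Y.1 v).
Proof.
move=> lin1 lin2; rewrite /twist_br /= (trilinear0 (@br_trilinear k g)).
by rewrite !(trilinear0 lin1) (trilinear0 lin2) !add0r addr0.
Qed.

Lemma twist_act_inr (k : fieldType) (g h : threeLie k)
    (V W : lmodType k) (rho : g -> g -> h -> h) (rhoW : g -> g -> W -> W)
    (al : V -> g -> h -> W) (nu : g -> g -> h -> W) (X Y : g * V) (w : W) :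
  trilinear rho -> trilinear al -> trilinear nu ->
  twist_act rho rhoW al nu X Y (0, w) = (0, rhoW X.1 Y.1 w).
Proof.
move=> lin1 lin2 lin3; rewrite /twist_act /= (trilinear0 lin1).
by rewrite !(trilinear0 lin2) (trilinear0 lin3) subr0 !addr0.
Qed.

Lemma twist_act_inl (k : fieldType) (g h : threeLie k)
    (V W : lmodType k) (rho : g -> g -> h -> h) (rhoW : g -> g -> W -> W)
    (al : V -> g -> h -> W) (nu : g -> g -> h -> W) (v : V) (Y : g * V)
    (A : h * W) :
  trilinear rho -> trilinear rhoW -> trilinear al -> trilinear nu ->
  twist_act rho rhoW al nu (0, v) Y A = (0, al v Y.1 A.1).
Proof.
move=> lin1 lin2 lin3 lin4; rewrite /twist_act /= (trilinear0 lin1).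
by rewrite (trilinear0 lin2) !(trilinear0 lin3) (trilinear0 lin4) subr0 add0r
  addr0.
Qed.

Definition twist_threeLie (k : fieldType) (g : threeLie k) (V : lmodType k)
    (rho : g -> g -> V -> V) (om : g -> g -> g -> V) (rhoP : is_repr rho)
    (lin : trilinear om) (alt : alternating3 om) (coc : cocycle3 rho om) :
    threeLie k :=
  @ThreeLie k (g * V)%type (twist_br rho om)
    (twist_br_trilinear (repr_trilinear rhoP) lin)
    (twist_br_alternating (repr_trilinear rhoP) (repr_alternating rhoP) alt)
    (fun X1 X2 Y1 Y2 Y3 => proj2 (twist_fundamental_iff om X1 X2 Y1 Y2 Y3 rhoP)
      (coc X1.1 X2.1 Y1.1 Y2.1 Y3.1)).

(** * The extension of a cocycle *)

Section ProductMaps.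
Variables (k : fieldType) (U V : lmodType k).

Definition inl_lin (u : U) : U * V := (u, 0).
Definition inr_lin (v : V) : U * V := (0, v).

Lemma inl_lin_is_linear : linear inl_lin.
Proof. by move=> l u u'; congr pair; rewrite /= scaler0 addr0. Qed.

Lemma inr_lin_is_linear : linear inr_lin.
Proof. by move=> l v v'; congr pair; rewrite /= scaler0 addr0. Qed.

HB.instance Definition _ :=
  GRing.isLinear.Build k U (U * V)%type *:%R inl_lin inl_lin_is_linear.
HB.instance Definition _ :=
  GRing.isLinear.Build k V (U * V)%type *:%R inr_lin inr_lin_is_linear.

Lemma inr_fst_exact :
  short_exact (inr_lin : {linear V -> (U * V)%type})
    (fst : {linear (U * V)%type -> U}).
Proof.
split=> [v v' []//|[u v]|u]; last by exists (u, 0).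
by split=> [/= ->|[v' [<-]]//]; exists v.
Qed.

End ProductMaps.

Section TwistedExtension.
Variables (k : fieldType) (M : matchedPair k) (V W : lmodType k).
Variables (R : mpRepr M V W) (c : cochain2 M V W) (cP : is_cocycle2 R c).

Let cochainP := coc_cochain cP.

Definition twist_g : threeLie k :=
  twist_threeLie (mpr_rhoV (mpReprP R)) (omega_trilinear cochainP)
    (omega_alternating cochainP) (coc_Z1 cP).

Definition twist_h : threeLie k :=
  twist_threeLie (mpr_psiW (mpReprP R)) (theta_trilinear cochainP)
    (theta_alternating cochainP) (coc_Z2 cP).

Lemma twist_is_matched_pair :
  @is_matched_pair k twist_g twist_h (twisted_rho R c) (twisted_psi R c).
Proof.
have [? ? ? ? ? ? ? ?] := cochainP.
have RP := mpReprP R; have MP := mpP M.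
split.
- apply: twist_act_trilinear => //; [exact: mp_rho_trilinear MP|
    exact: repr_trilinear (mpr_rhoW RP)|exact: mpr_alpha RP].
- apply: twist_act_alternating => //; [exact: mp_rho_alternating MP|
    exact: repr_alternating (mpr_rhoW RP)].
- apply: twist_act_trilinear => //; [exact: mp_psi_trilinear MP|
    exact: repr_trilinear (mpr_psiV RP)|exact: mpr_beta RP].
- apply: twist_act_alternating => //; [exact: mp_psi_alternating MP|
    exact: repr_alternating (mpr_psiV RP)].
- by move=> *; apply/twisted_M1_iff; apply: coc_Z4.
- by move=> *; apply/twisted_M2_iff; apply: coc_Z5.
- by move=> *; apply/twisted_M3_iff; apply: coc_Z7.
(* M4-M6 are M1-M3 for the swapped data, where the remainders are Z3, Z6 and Z8. *)
- move=> *; apply/(twisted_M1_iff (swap_repr R) (swap_cochain c)).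
  exact: coc_Z3.
- move=> *; apply/(twisted_M2_iff (swap_repr R) (swap_cochain c)).
  exact: coc_Z6.
- move=> *; apply/(twisted_M3_iff (swap_repr R) (swap_cochain c)).
  exact: coc_Z8.
Qed.

Definition twist_mp : matchedPair k := MatchedPair twist_is_matched_pair.

(** The right-hand sides see the other arguments only through their first components. This gives
    both the induced representation and its independence of the section. *)
Lemma twisted_inclE :
  [/\ forall X1 X2 v, twist_br (rhoV R) (c_omega c) X1 X2 (0, v) =
        (0, rhoV R X1.1 X2.1 v),
      forall A1 A2 w, twist_br (psiW R) (c_theta c) A1 A2 (0, w) =
        (0, psiW R A1.1 A2.1 w),
      forall X1 X2 w, twisted_rho R c X1 X2 (0, w) = (0, rhoW R X1.1 X2.1 w)
    & forall A1 A2 v, twisted_psi R c A1 A2 (0, v) = (0, psiV R A1.1 A2.1 v)] /\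
  (forall v Y A, twisted_rho R c (0, v) Y A = (0, alpha R v Y.1 A.1)) /\
  (forall w B X, twisted_psi R c (0, w) B X = (0, beta R w B.1 X.1)).
Proof.
have RP := mpReprP R; have [? _ ? _ ? _ ? _] := cochainP.
have linr := mp_rho_trilinear (mpP M); have linp := mp_psi_trilinear (mpP M).
have linV := repr_trilinear (mpr_rhoV RP).
have linV' := repr_trilinear (mpr_psiV RP).
have linW := repr_trilinear (mpr_rhoW RP).
have linW' := repr_trilinear (mpr_psiW RP).
have lina := mpr_alpha RP; have linb := mpr_beta RP.
do 2?[split] => *; first [exact: twist_br_inr|exact: twist_act_inr|
  exact: twist_act_inl].
Qed.

Lemma twist_incl_morphism :
  @is_mp_morphism k (zero_matchedPair V W) twist_mp
    (@inr_lin k (mp_g M) V : {linear V -> (mp_g M * V)%type})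
    (@inr_lin k (mp_h M) W : {linear W -> (mp_h M * W)%type}).
Proof.
have [[gI hI rI pI] _] := twisted_inclE; have RP := mpReprP R.
split=> *; symmetry; [apply: etrans (gI _ _ _) _|apply: etrans (hI _ _ _) _|
  apply: etrans (rI _ _ _) _|apply: etrans (pI _ _ _) _]; congr pair.
- by rewrite (trilinear0 (repr_trilinear (mpr_rhoV RP))).
- by rewrite (trilinear0 (repr_trilinear (mpr_psiW RP))).
- by rewrite (trilinear0 (repr_trilinear (mpr_rhoW RP))).
- by rewrite (trilinear0 (repr_trilinear (mpr_psiV RP))).
Qed.

Lemma twist_proj_morphism :
  @is_mp_morphism k twist_mp M
    (fst : {linear (mp_g M * V)%type -> mp_g M})
    (fst : {linear (mp_h M * W)%type -> mp_h M}).
Proof. by split. Qed.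

Definition twist_ext : extension M V W :=
  @Extension k M V W twist_mp _ _ _ _ twist_incl_morphism twist_proj_morphism
    (@inr_fst_exact k (mp_g M) V) (@inr_fst_exact k (mp_h M) W).

Lemma twist_ext_induces : has_induced_repr R twist_ext.
Proof.
have [[gI hI rI pI] [rL pL]] := twisted_inclE; split; last first.
  exists (@inl_lin k (mp_g M) V : {linear mp_g M -> (mp_g M * V)%type}).
  exists (@inl_lin k (mp_h M) W : {linear mp_h M -> (mp_h M * W)%type}).
  split=> //; split=> *; symmetry;
    [exact: gI|exact: rI|exact: pI|exact: hI|exact: rL|exact: pL].
split=> /= [X1 X2 Y1 Y2 v|X1 X2 Y1 Y2 w|A1 A2 B1 B2 v|A1 A2 B1 B2 w|v X Y A B|
  w A B X Y] eq1 eq2.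
- by rewrite !gI eq1 eq2.
- by rewrite !rI eq1 eq2.
- by rewrite !pI eq1 eq2.
- by rewrite !hI eq1 eq2.
- by rewrite !rL eq1 eq2.
- by rewrite !pL eq1 eq2.
Qed.

End TwistedExtension.

(** * The cocycle of a section *)

(** Since [i] is injective, pointwise lifts are unique, so a choice of them is automatically
    linear. *)
Lemma linear_lift (k : fieldType) (A B V : lmodType k) (i : {linear V -> B})
    (d : {linear A -> B}) :
  injective i -> (forall x, exists v, i v = d x) ->
  exists N : {linear A -> V}, forall x, i (N x) = d x.
Proof.
move=> inj_i /choice[N iN].
have linN : linear N by move=> l x y; apply: inj_i; rewrite linearP !iN linearP.
pose Nl : {linear A -> V} :=
  HB.pack N (GRing.isLinear.Build k A V *:%R N linN).
by exists Nl.
Qed.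

Section Splitting.
Variables (k : fieldType) (A B V : lmodType k).
Variables (i : {linear V -> B}) (j : {linear B -> A}) (s : {linear A -> B}).
Hypotheses (exact_ij : short_exact i j) (sK : forall x, j (s x) = x).

(** The identification of the direct sum of A and V with B that the section [s] determines. *)
Definition glue (X : A * V) : B := s X.1 + i X.2.

Lemma exact_comp0 v : j (i v) = 0.
Proof. by case: exact_ij => _ exact_ij' _; apply/exact_ij'; exists v. Qed.

Lemma glue_fst X : j (glue X) = X.1.
Proof. by rewrite /glue raddfD /= sK exact_comp0 addr0. Qed.

Lemma glue_inj : injective glue.
Proof.
case: exact_ij => inj_i _ _ [x v] [y w] eq_xy.
have /= exy : j (glue (x, v)) = j (glue (y, w)) by rewrite eq_xy.
rewrite !glue_fst /= in exy; move: eq_xy; rewrite /glue exy /=.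
by move=> /addrI/inj_i ->.
Qed.

Lemma glueD X Y : glue (X + Y) = glue X + glue Y.
Proof. by rewrite /glue !raddfD /=; zmod. Qed.

Lemma glueN X : glue (- X) = - glue X.
Proof. by rewrite /glue !raddfN opprD. Qed.

Lemma glue_inl x : glue (x, 0) = s x.
Proof. by rewrite /glue raddf0 addr0. Qed.

Lemma glue_inr v : glue (0, v) = i v.
Proof. by rewrite /glue raddf0 add0r. Qed.

(** The element [b - s (j b)] is killed by [j], hence comes from V, and it depends linearly on
    [b]. *)
Lemma glue_retract :
  exists r : {linear B -> V}, forall b, glue (j b, r b) = b.
Proof.
have [inj_i ker_j _] := exact_ij.
have [|r rP] := @linear_lift k B B V i (idfun \- (s \o j)) inj_i.
  by move=> b; apply/ker_j; rewrite /= raddfB /= sK subrr.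
by exists r => b; rewrite /glue /= rP /= addrC subrK.
Qed.

Lemma glue_surj b : exists X, glue X = b.
Proof. by have [r rP] := glue_retract; exists (j b, r b). Qed.

End Splitting.

(** The map is one [glue] after the inverse of the other. Writing it as [s' \o j] plus [i' \o r]
    makes linearity immediate. *)
Lemma glue_iso (k : fieldType) (A B B' V : lmodType k)
    (i : {linear V -> B}) (j : {linear B -> A}) (s : {linear A -> B})
    (i' : {linear V -> B'}) (j' : {linear B' -> A}) (s' : {linear A -> B'}) :
  short_exact i j -> (forall x, j (s x) = x) ->
  short_exact i' j' -> (forall x, j' (s' x) = x) ->
  exists2 f : {linear B -> B'}, bijective f &
    forall X, f (glue i s X) = glue i' s' X.
Proof.
move=> ex sK ex' sK'.
have [r rP] := glue_retract ex sK; have [r' rP'] := glue_retract ex' sK'.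
pose f : {linear B -> B'} := (s' \o j) \+ (i' \o r).
have fE X : f (glue i s X) = glue i' s' X.
  have /= rE := congr1 snd (glue_inj ex sK (rP (glue i s X))).
  by rewrite /f /= (glue_fst ex sK) rE.
exists f => //; exists (glue i s \o (fun b => (j' b, r' b))) => b.
  apply: (etrans _ (rP b)); congr (glue i s _); apply: (glue_inj ex' sK').
  by rewrite rP' -fE rP.
exact: (etrans (fE _) (rP' b)).
Qed.

(** * Presentations of an extension by a cochain *)

Definition add_cochain2 (k : fieldType) (M : matchedPair k) (V W : lmodType k)
    (c c' : cochain2 M V W) : cochain2 M V W := {|
  c_omega x1 x2 x3 := c_omega c x1 x2 x3 + c_omega c' x1 x2 x3;
  c_theta a1 a2 a3 := c_theta c a1 a2 a3 + c_theta c' a1 a2 a3;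
  c_nu x1 x2 a := c_nu c x1 x2 a + c_nu c' x1 x2 a;
  c_phi a1 a2 x := c_phi c a1 a2 x + c_phi c' a1 a2 x
|}.

(* [glue] along the sections is an isomorphism from the twisted extension by
   [c] onto E. *)
Record presents (k : fieldType) (M : matchedPair k) (V W : lmodType k)
    (R : mpRepr M V W) (E : extension M V W) (c : cochain2 M V W)
    (s1 : {linear mp_g M -> mp_g E}) (s2 : {linear mp_h M -> mp_h E}) :
    Prop := {
  pres_section : is_section s1 s2;
  pres_br_g : forall X1 X2 X3,
    br (glue (ext_i1 E) s1 X1) (glue (ext_i1 E) s1 X2) (glue (ext_i1 E) s1 X3) =
    glue (ext_i1 E) s1 (twist_br (rhoV R) (c_omega c) X1 X2 X3);
  pres_br_h : forall A1 A2 A3,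
    br (glue (ext_i2 E) s2 A1) (glue (ext_i2 E) s2 A2) (glue (ext_i2 E) s2 A3) =
    glue (ext_i2 E) s2 (twist_br (psiW R) (c_theta c) A1 A2 A3);
  pres_rho : forall X1 X2 A,
    mp_rho (glue (ext_i1 E) s1 X1) (glue (ext_i1 E) s1 X2)
      (glue (ext_i2 E) s2 A) =
    glue (ext_i2 E) s2
      (twist_act (@mp_rho k M) (rhoW R) (alpha R) (c_nu c) X1 X2 A);
  pres_psi : forall A1 A2 X,
    mp_psi (glue (ext_i2 E) s2 A1) (glue (ext_i2 E) s2 A2)
      (glue (ext_i1 E) s1 X) =
    glue (ext_i1 E) s1
      (twist_act (@mp_psi k M) (psiV R) (beta R) (c_phi c) A1 A2 X)
}.

(* The half of [presents] that concerns g; the other half is this one for the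
   swapped matched pair. *)
Definition presents_half (k : fieldType) (M : matchedPair k) (V W : lmodType k)
    (R : mpRepr M V W) (E : extension M V W)
    (om : mp_g M -> mp_g M -> mp_g M -> V)
    (ph : mp_h M -> mp_h M -> mp_g M -> V)
    (s1 : {linear mp_g M -> mp_g E}) (s2 : {linear mp_h M -> mp_h E}) : Prop :=
  [/\ forall x, ext_j1 E (s1 x) = x,
      forall X1 X2 X3,
        br (glue (ext_i1 E) s1 X1) (glue (ext_i1 E) s1 X2)
          (glue (ext_i1 E) s1 X3) =
        glue (ext_i1 E) s1 (twist_br (rhoV R) om X1 X2 X3)
    & forall A1 A2 X,
        mp_psi (glue (ext_i2 E) s2 A1) (glue (ext_i2 E) s2 A2)
          (glue (ext_i1 E) s1 X) =
        glue (ext_i1 E) s1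
          (twist_act (@mp_psi k M) (psiV R) (beta R) ph A1 A2 X)].

Lemma swap_incl_morphism (k : fieldType) (M : matchedPair k) (V W : lmodType k)
    (E : extension M V W) :
  @is_mp_morphism k (zero_matchedPair W V) (swap_mp E) (ext_i2 E) (ext_i1 E).
Proof. by case: (ext_i_mor E) => *; split. Qed.

Lemma swap_proj_morphism (k : fieldType) (M : matchedPair k) (V W : lmodType k)
    (E : extension M V W) :
  @is_mp_morphism k (swap_mp E) (swap_mp M) (ext_j2 E) (ext_j1 E).
Proof. by case: (ext_j_mor E) => *; split. Qed.

Definition swap_ext (k : fieldType) (M : matchedPair k) (V W : lmodType k)
    (E : extension M V W) : extension (swap_mp M) W V :=
  @Extension k (swap_mp M) W V (swap_mp E) _ _ _ _ (swap_incl_morphism E)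
    (swap_proj_morphism E) (ext_exact2 E) (ext_exact1 E).

Section Presentations.
Variables (k : fieldType) (M : matchedPair k) (V W : lmodType k).
Variables (R : mpRepr M V W).
Implicit Types (E : extension M V W) (c : cochain2 M V W).

Lemma swap_presents E c s1 s2 :
  presents R c s1 s2 ->
  presents (E := swap_ext E) (swap_repr R) (swap_cochain c) s2 s1.
Proof. by case=> -[? ?] *; split. Qed.

(** As [glue] is injective and carries the twisted operations to those of [E], the identities of [E]
    pull back. At pairs [(x, 0)] the cochain appears as the failure of the sections to preserve the
    operations, whence its multilinearity and alternation. *)
Lemma presents_half_cocycle E c s1 s2 :
  presents (E := E) R c s1 s2 ->
  [/\ trilinear (c_omega c) /\ alternating3 (c_omega c),
      trilinear (c_phi c) /\ alternating2 (c_phi c)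
    & cocycle3 (rhoV R) (c_omega c)] /\
  [/\ forall A1 A2 X1 X2 X3 : _ * _,
        let b := twisted_br R c in let psi := twisted_psi R c in
        psi A1 A2 (b X1 X2 X3) =
          b (psi A1 A2 X1) X2 X3 + b X1 (psi A1 A2 X2) X3
          + b X1 X2 (psi A1 A2 X3),
      forall A1 A2 X1 X2 X3,
        let b := twisted_br R c in let psi := twisted_psi R c in
        let rho := twisted_rho R c in
        - psi (rho X1 X2 A1) A2 X3 =
          - psi (rho X1 X3 A2) A1 X2 + psi (rho X2 X3 A2) A1 X1
          - b X1 X2 (psi A1 A2 X3)
    & forall A1 A2 X1 X2 X3,
        let b := twisted_br R c in let psi := twisted_psi R c in
        let rho := twisted_rho R c in
        b (psi A1 A2 X1) X2 X3 =
          psi A1 A2 (b X1 X2 X3) + psi (rho X2 X3 A1) A2 X1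
          + psi A1 (rho X2 X3 A2) X1].
Proof.
case=> -[s1K _] brg _ prho ppsi.
have inj1 := glue_inj (ext_exact1 E) s1K.
have [inj_i1 _ _] := ext_exact1 E.
have om x1 x2 x3 : ext_i1 E (c_omega c x1 x2 x3) =
    br (s1 x1) (s1 x2) (s1 x3) - s1 (br x1 x2 x3).
  have := brg (x1, 0) (x2, 0) (x3, 0); rewrite !glue_inl => ->.
  rewrite /glue /twist_br /=.
  rewrite !(trilinear0 (repr_trilinear (mpr_rhoV (mpReprP R)))).
  by rewrite !add0r addrC addKr.
have ph a1 a2 x : ext_i1 E (c_phi c a1 a2 x) =
    mp_psi (s2 a1) (s2 a2) (s1 x) - s1 (mp_psi a1 a2 x).
  have := ppsi (a1, 0) (a2, 0) (x, 0); rewrite !glue_inl => ->.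
  rewrite /glue /twist_act /=.
  rewrite (trilinear0 (repr_trilinear (mpr_psiV (mpReprP R)))).
  by rewrite !(trilinear0 (mpr_beta (mpReprP R))) subr0 !add0r addrC addKr.
split; split.
- split.
    have [l1 l2 l3] := @br_trilinear k (mp_g E).
    have [m1 m2 m3] := @br_trilinear k (mp_g M).
    split=> x y l z t; apply: inj_i1.
    + by rewrite linearP !om linearP l1 m1 linearP /= scalerBr; zmod.
    + by rewrite linearP !om linearP l2 m2 linearP /= scalerBr; zmod.
    + by rewrite linearP !om linearP l3 m3 linearP /= scalerBr; zmod.
  move=> x y; have [e1 e2 e3] := @br_alternating k (mp_g E) (s1 x) (s1 y).
  have [d1 d2 d3] := @br_alternating k (mp_g M) x y.
  by split; apply: inj_i1; rewrite om ?e1 ?e2 ?e3 ?d1 ?d2 ?d3 !raddf0 addr0.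
- split.
    have [l1 l2 l3] := mp_psi_trilinear (mpP E).
    have [m1 m2 m3] := mp_psi_trilinear (mpP M).
    split=> x y l z t; apply: inj_i1.
    + by rewrite linearP !ph linearP l1 m1 linearP /= scalerBr; zmod.
    + by rewrite linearP !ph linearP l2 m2 linearP /= scalerBr; zmod.
    + by rewrite linearP !ph linearP l3 m3 linearP /= scalerBr; zmod.
  move=> a x; apply: inj_i1.
  rewrite ph (mp_psi_alternating (mpP E)) (mp_psi_alternating (mpP M)).
  by rewrite !raddf0 addr0.
- move=> x1 x2 x3 x4 x5.
  have := twist_fundamental_iff (c_omega c) (x1, 0) (x2, 0) (x3, 0) (x4, 0)
    (x5, 0) (mpr_rhoV (mpReprP R)) => /= -[+ _]; apply.
  by apply: inj1; rewrite !glueD -!brg br_fundamental.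
- move=> A1 A2 X1 X2 X3 /=; apply: inj1.
  by rewrite !glueD -!ppsi -!brg -!ppsi (mp_M1 (mpP E)).
- move=> A1 A2 X1 X2 X3 /=; apply: inj1.
  by rewrite !(glueD, glueN) -!ppsi -!brg -!prho -!ppsi (mp_M2 (mpP E)).
- move=> A1 A2 X1 X2 X3 /=; apply: inj1.
  by rewrite !glueD -!ppsi -!brg -!prho -!ppsi (mp_M3 (mpP E)).
Qed.

(** The cochain is the failure of the sections to be compatible with the operations. Expanding an
    operation on glued elements leaves this failure, the induced actions, and terms with two or more
    entries from V and W, which vanish by section independence. *)
Lemma induced_half_cochain E s1 s2 :
  section_independent E -> is_section s1 s2 -> induces (E := E) s1 s2 R ->
  exists om ph, presents_half R om ph s1 s2.
Proof.
move=> [irV _ _ _ _ ib] [s1K s2K] [rV _ pV _ _ be].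
have [_ ker1 _] := ext_exact1 E.
have j1i v : ext_j1 E (ext_i1 E v) = 0 := exact_comp0 (ext_exact1 E) v.
have j2i w : ext_j2 E (ext_i2 E w) = 0 := exact_comp0 (ext_exact2 E) w.
have linbr := @br_trilinear k (mp_g E).
have altbr := @br_alternating k (mp_g E).
have linpsi := mp_psi_trilinear (mpP E).
have skew := alternating2C linpsi (mp_psi_alternating (mpP E)).
have cyc := alternating3_cycle linbr altbr.
(* The defect of [s1] dies under [ext_j1], so it lies in V by exactness. *)
have [|om' omP] := @choice (mp_g M * mp_g M * mp_g M) V (fun x v =>
    ext_i1 E v = br (s1 x.1.1) (s1 x.1.2) (s1 x.2) - s1 (br x.1.1 x.1.2 x.2)).
  move=> x; apply/ker1.
  by rewrite raddfB /= (mor_br_g (ext_j_mor E)) !s1K subrr.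
have [|ph' phP] := @choice (mp_h M * mp_h M * mp_g M) V (fun x v =>
    ext_i1 E v =
    mp_psi (s2 x.1.1) (s2 x.1.2) (s1 x.2) - s1 (mp_psi x.1.1 x.1.2 x.2)).
  move=> x; apply/ker1.
  by rewrite raddfB /= (mor_psi (ext_j_mor E)) !s1K !s2K subrr.
exists (fun x1 x2 x3 => om' (x1, x2, x3)), (fun a1 a2 x => ph' (a1, a2, x)).
split=> //.
- move=> [x1 v1] [x2 v2] [x3 v3]; rewrite /glue /twist_br /=.
  (* An entry from V and 0 have the same image in g, so section independence allows replacing one by
     the other. *)
  have br0 X v v' : br X (ext_i1 E v) (ext_i1 E v') = 0.
    rewrite (irV X (ext_i1 E v) X 0 v') ?(trilinear0 linbr) //.
    by rewrite j1i raddf0.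
  (* Cyclic rotations bring an entry of V to the last slot, where the action terms and [br0] are
     stated. *)
  rewrite !raddfD /= omP !rV !(trilinearE linbr) /= !(cyc (ext_i1 E v1)).
  by rewrite -!(cyc (s1 x3) (s1 x1)) !(cyc (ext_i1 E v2)) !br0; zmod.
- move=> [a1 w1] [a2 w2] [x v]; rewrite /glue /twist_act /=.
  have psi0 w A v' : mp_psi (ext_i2 E w) A (ext_i1 E v') = 0.
    by rewrite (ib w A A _ 0) ?(trilinear0 linpsi) // j1i raddf0.
  have psi00 w w' X : mp_psi (ext_i2 E w) (ext_i2 E w') X = 0.
    by rewrite (ib w _ 0 X X) ?(trilinear0 linpsi) // j2i raddf0.
  rewrite !(raddfD, raddfN) /= phP !pV !be !(trilinearE linpsi) /=.
  by rewrite !(skew (s2 a1) (ext_i2 E w2)) !psi00 !psi0; zmod.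
Qed.

(** Moving the section by [N1] amounts to the substitution of [(x, v + N1 x)] for [(x, v)], and
    likewise for [N2]. The terms in [N1] and [N2] that this creates in the twisted operations are
    those of [D1 R N1 N2]. *)
Lemma presents_shift_half E c s1 s2 (s1' : {linear mp_g M -> mp_g E})
    (s2' : {linear mp_h M -> mp_h E})
    (N1 : {linear mp_g M -> V}) (N2 : {linear mp_h M -> W}) :
  presents (E := E) R c s1 s2 ->
  (forall x, s1' x = s1 x + ext_i1 E (N1 x)) ->
  (forall a, s2' a = s2 a + ext_i2 E (N2 a)) ->
  let c' := add_cochain2 c (D1 R N1 N2) in
  presents_half R (c_omega c') (c_phi c') s1' s2'.
Proof.
move=> P s1E s2E c'.
have glue1 X : glue (ext_i1 E) s1' X = glue (ext_i1 E) s1 (X.1, X.2 + N1 X.1).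
  by rewrite /glue /= s1E raddfD /= addrAC addrA.
have glue2 A : glue (ext_i2 E) s2' A = glue (ext_i2 E) s2 (A.1, A.2 + N2 A.1).
  by rewrite /glue /= s2E raddfD /= addrAC addrA.
have lin1 := repr_trilinear (mpr_rhoV (mpReprP R)).
have lin2 := repr_trilinear (mpr_psiV (mpReprP R)).
have linb := mpr_beta (mpReprP R).
split=> *.
- rewrite s1E raddfD /= (exact_comp0 (ext_exact1 E)).
  by rewrite (pres_section P).1 addr0.
- rewrite !glue1 (pres_br_g P); congr (glue _ _ (_, _)).
  by rewrite /= !(trilinearE lin1) /=; zmod.
- rewrite !(glue1, glue2) (pres_psi P); congr (glue _ _ (_, _)).
  by rewrite /= !(trilinearE lin2, trilinearE linb) /=; zmod.
Qed.

Lemma presents_inj_half E c c' s1 s2 :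
  presents (E := E) R c s1 s2 -> presents R c' s1 s2 ->
  (forall x1 x2 x3, c_omega c x1 x2 x3 = c_omega c' x1 x2 x3) /\
  (forall a1 a2 x, c_phi c a1 a2 x = c_phi c' a1 a2 x).
Proof.
move=> P P'; have inj := glue_inj (ext_exact1 E) (pres_section P).1.
split=> [x1 x2 x3|a1 a2 x].
  have := pres_br_g P (x1, 0) (x2, 0) (x3, 0).
  by rewrite (pres_br_g P') => /inj[] /addrI.
have := pres_psi P (a1, 0) (a2, 0) (x, 0).
by rewrite (pres_psi P') => /inj[] /addrI.
Qed.

Lemma cochain_ext c c' :
  (forall x1 x2 x3, c_omega c x1 x2 x3 = c_omega c' x1 x2 x3) ->
  (forall a1 a2 a3, c_theta c a1 a2 a3 = c_theta c' a1 a2 a3) ->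
  (forall x1 x2 a, c_nu c x1 x2 a = c_nu c' x1 x2 a) ->
  (forall a1 a2 x, c_phi c a1 a2 x = c_phi c' a1 a2 x) -> c = c'.
Proof.
case: c c' => [om th nu ph] [om' th' nu' ph'] /= eq_om eq_th eq_nu eq_ph.
by congr Cochain2; apply/funext => x; apply/funext => y; apply/funext => z.
Qed.

Lemma swap_section_independent E :
  section_independent E -> section_independent (swap_ext E).
Proof. by case=> *; split. Qed.

Lemma swap_induces E s1 s2 :
  induces (E := E) s1 s2 R ->
  induces (E := swap_ext E) s2 s1 (swap_repr R).
Proof. by case=> *; split. Qed.

End Presentations.

(** * Classification *)

Section Classification.
Variables (k : fieldType) (M : matchedPair k) (V W : lmodType k).
Variables (R : mpRepr M V W).
Implicit Types (E : extension M V W) (c : cochain2 M V W).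

(** M1-M6 for the twisted operations, taken at pairs with zero second component, are equivalent to
    Z3-Z8. The half for h comes from the swapped presentation. *)
Lemma presents_cocycle E c s1 s2 :
  presents (E := E) R c s1 s2 -> is_cocycle2 R c.
Proof.
move=> P; have [[[? ?] [? ?] Z1] [T1 T2 T3]] := presents_half_cocycle P.
have [[[? ?] [? ?] Z2] [T4 T5 T6]] := presents_half_cocycle (swap_presents P).
split=> //=.
- move=> x1 x2 a1 a2 a3.
  by have /twisted_M1_iff := T4 (x1, 0) (x2, 0) (a1, 0) (a2, 0) (a3, 0).
- move=> a1 a2 x1 x2 x3.
  by have /twisted_M1_iff := T1 (a1, 0) (a2, 0) (x1, 0) (x2, 0) (x3, 0).
- move=> a1 a2 x1 x2 x3.
  by have /twisted_M2_iff := T2 (a1, 0) (a2, 0) (x1, 0) (x2, 0) (x3, 0).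
- move=> x1 x2 a1 a2 a3.
  by have /twisted_M2_iff := T5 (x1, 0) (x2, 0) (a1, 0) (a2, 0) (a3, 0).
- move=> a1 a2 x1 x2 x3.
  by have /twisted_M3_iff := T3 (a1, 0) (a2, 0) (x1, 0) (x2, 0) (x3, 0).
- move=> x1 x2 a1 a2 a3.
  by have /twisted_M3_iff := T6 (x1, 0) (x2, 0) (a1, 0) (a2, 0) (a3, 0).
Qed.

Lemma presents_exists E : has_induced_repr R E ->
  exists c s1 s2, presents (E := E) R c s1 s2.
Proof.
move=> [indep [s1 [s2 [sec ind]]]].
have [om [ph [_ br1 psi1]]] := induced_half_cochain indep sec ind.
have [th [nu [_ br2 rho2]]] :=
  induced_half_cochain (swap_section_independent indep)
    (conj (proj2 sec) (proj1 sec)) (swap_induces ind).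
by exists (Cochain2 om th nu ph), s1, s2; split.
Qed.

(** Along the canonical inclusions of g and h, [glue] is the identity. *)
Lemma twist_ext_presented c (cP : is_cocycle2 R c) :
  exists s1 s2, presents (E := twist_ext cP) R c s1 s2.
Proof.
exists (@inl_lin k (mp_g M) V : {linear mp_g M -> (mp_g M * V)%type}).
exists (@inl_lin k (mp_h M) W : {linear mp_h M -> (mp_h M * W)%type}).
have glueE (A B : lmodType k) (X : A * B) :
    glue (@inr_lin k A B : {linear B -> (A * B)%type})
      (@inl_lin k A B : {linear A -> (A * B)%type}) X = X.
  by case: X => x v; rewrite /glue /= pair_addE /= addr0 add0r.
by split=> //= *; rewrite !glueE.
Qed.

Lemma presents_shift E c s1 s2 (s1' : {linear mp_g M -> mp_g E})
    (s2' : {linear mp_h M -> mp_h E})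
    (N1 : {linear mp_g M -> V}) (N2 : {linear mp_h M -> W}) :
  presents (E := E) R c s1 s2 ->
  (forall x, s1' x = s1 x + ext_i1 E (N1 x)) ->
  (forall a, s2' a = s2 a + ext_i2 E (N2 a)) ->
  presents R (add_cochain2 c (D1 R N1 N2)) s1' s2'.
Proof.
move=> P s1E s2E; have [? ? ?] := presents_shift_half P s1E s2E.
by have [? ? ?] := presents_shift_half (swap_presents P) s2E s1E; split.
Qed.

Lemma presents_inj E c c' s1 s2 :
  presents (E := E) R c s1 s2 -> presents R c' s1 s2 -> c = c'.
Proof.
move=> P P'; have [? ?] := presents_inj_half P P'.
have [? ?] := presents_inj_half (swap_presents P) (swap_presents P').
exact: cochain_ext.
Qed.

Lemma cohomologousP c c' :
  cohomologous R c c' <-> exists N1 N2, c = add_cochain2 c' (D1 R N1 N2).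
Proof.
split=> -[N1 [N2 e]]; exists N1, N2.
  by rewrite -e; apply: cochain_ext => * /=; rewrite addrC subrK.
by rewrite e; apply: cochain_ext => * /=; rewrite addrC addKr.
Qed.

(** Two sections differ by linear maps [N1], [N2] into the kernels V and W. Shifting the second
    presentation by them gives one along the first sections, where the cochain is unique. *)
Lemma presents_cohomologous E c c' s1 s2 s1' s2' :
  presents (E := E) R c s1 s2 -> presents (E := E) R c' s1' s2' ->
  cohomologous R c c'.
Proof.
move=> P P'; have [s1K s2K] := pres_section P.
have [s1K' s2K'] := pres_section P'.
have [inj1 ker1 _] := ext_exact1 E; have [inj2 ker2 _] := ext_exact2 E.
have [|N1 N1E] := @linear_lift k _ _ _ (ext_i1 E) (s1 \- s1') inj1.
  by move=> x; apply/ker1; rewrite raddfB /= s1K s1K' subrr.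
have [|N2 N2E] := @linear_lift k _ _ _ (ext_i2 E) (s2 \- s2') inj2.
  by move=> a; apply/ker2; rewrite raddfB /= s2K s2K' subrr.
apply/cohomologousP; exists N1, N2; apply: (presents_inj P).
by apply: (presents_shift P') => x; rewrite ?N1E ?N2E /= addrC subrK.
Qed.

(** A morphism compatible with inclusions and projections sends sections to sections and commutes
    with [glue]. *)
Lemma presents_transport E E' c s1 s2 (f : {linear mp_g E -> mp_g E'})
    (g : {linear mp_h E -> mp_h E'}) :
  is_mp_morphism f g ->
  (forall v, f (ext_i1 E v) = ext_i1 E' v) ->
  (forall w, g (ext_i2 E w) = ext_i2 E' w) ->
  (forall X, ext_j1 E' (f X) = ext_j1 E X) ->
  (forall A, ext_j2 E' (g A) = ext_j2 E A) ->
  presents (E := E) R c s1 s2 -> presents (E := E') R c (f \o s1) (g \o s2).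
Proof.
move=> [fbr gbr grho fpsi] fi gi fj gj [[s1K s2K] brg brh prho ppsi].
have glue1 X : glue (ext_i1 E') (f \o s1) X = f (glue (ext_i1 E) s1 X).
  by rewrite /glue raddfD /= fi.
have glue2 A : glue (ext_i2 E') (g \o s2) A = g (glue (ext_i2 E) s2 A).
  by rewrite /glue raddfD /= gi.
split.
- by split=> x /=; rewrite ?fj ?gj ?s1K ?s2K.
- by move=> *; rewrite !glue1 -fbr brg.
- by move=> *; rewrite !glue2 -gbr brh.
- by move=> *; rewrite !glue1 !glue2 -grho prho.
- by move=> *; rewrite !glue1 !glue2 -fpsi ppsi.
Qed.

(** Both extensions are identified by [glue] with the same twisted operations; the isomorphism is
    the composite of these identifications. *)
Lemma presents_isomorphic E E' c s1 s2 s1' s2' :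
  presents (E := E) R c s1 s2 -> presents (E := E') R c s1' s2' ->
  isomorphic_ext E E'.
Proof.
move=> P P'; have [s1K s2K] := pres_section P.
have [s1K' s2K'] := pres_section P'.
have ex1 := ext_exact1 E; have ex2 := ext_exact2 E.
have ex1' := ext_exact1 E'; have ex2' := ext_exact2 E'.
have [f bij_f fE] := glue_iso ex1 s1K ex1' s1K'.
have [g bij_g gE] := glue_iso ex2 s2K ex2' s2K'.
have surj1 := glue_surj ex1 s1K; have surj2 := glue_surj ex2 s2K.
exists f, g; split=> //; split.
- move=> Y1 Y2 Y3; have [X1 <-] := surj1 Y1; have [X2 <-] := surj1 Y2.
  by have [X3 <-] := surj1 Y3; rewrite (pres_br_g P) !fE (pres_br_g P').
- move=> Y1 Y2 Y3; have [X1 <-] := surj2 Y1; have [X2 <-] := surj2 Y2.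
  by have [X3 <-] := surj2 Y3; rewrite (pres_br_h P) !gE (pres_br_h P').
- move=> Y1 Y2 Y3; have [X1 <-] := surj1 Y1; have [X2 <-] := surj1 Y2.
  by have [X3 <-] := surj2 Y3; rewrite (pres_rho P) !fE !gE (pres_rho P').
- move=> Y1 Y2 Y3; have [X1 <-] := surj2 Y1; have [X2 <-] := surj2 Y2.
  by have [X3 <-] := surj1 Y3; rewrite (pres_psi P) !fE !gE (pres_psi P').
- by move=> v; have := fE (0, v); rewrite !glue_inr.
- by move=> v; have := gE (0, v); rewrite !glue_inr.
- by move=> Y; have [X <-] := surj1 Y; rewrite fE !glue_fst.
- by move=> Y; have [X <-] := surj2 Y; rewrite gE !glue_fst.
Qed.

Lemma cohomologous_refl c : cohomologous R c c.
Proof.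
have RP := mpReprP R.
have lin1 := repr_trilinear (mpr_rhoV RP).
have lin2 := repr_trilinear (mpr_psiV RP).
have lin3 := repr_trilinear (mpr_rhoW RP).
have lin4 := repr_trilinear (mpr_psiW RP).
have lina := mpr_alpha RP; have linb := mpr_beta RP.
exists \0, \0; apply: cochain_ext => * /=; rewrite subrr.
- by rewrite !(trilinear0 lin1); zmod.
- by rewrite !(trilinear0 lin4); zmod.
- by rewrite (trilinear0 lin3) !(trilinear0 lina); zmod.
- by rewrite (trilinear0 lin2) !(trilinear0 linb); zmod.
Qed.

(** [D1] is additive, so the differences of the two pairs of maps work. With reflexivity, this form
    yields symmetry and transitivity. *)
Lemma cohomologous_eucl c c' c'' :
  cohomologous R c c'' -> cohomologous R c' c'' -> cohomologous R c c'.
Proof.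
have RP := mpReprP R.
have lin1 := repr_trilinear (mpr_rhoV RP).
have lin2 := repr_trilinear (mpr_psiV RP).
have lin3 := repr_trilinear (mpr_rhoW RP).
have lin4 := repr_trilinear (mpr_psiW RP).
have lina := mpr_alpha RP; have linb := mpr_beta RP.
move=> /cohomologousP[N1 [N2 ->]] /cohomologousP[N1' [N2' ->]].
have [n1 n1E] : exists n1 : {linear mp_g M -> V}, forall x, n1 x = N1 x - N1' x.
  by exists (N1 \- N1').
have [n2 n2E] : exists n2 : {linear mp_h M -> W}, forall a, n2 a = N2 a - N2' a.
  by exists (N2 \- N2').
exists n1, n2; apply: cochain_ext => * /=; rewrite ?n1E ?n2E.
- by rewrite !(trilinearE lin1); zmod.
- by rewrite !(trilinearE lin4); zmod.
- by rewrite !(trilinearE lin3, trilinearE lina); zmod.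
- by rewrite !(trilinearE lin2, trilinearE linb); zmod.
Qed.
End Classification.

(** * Bijections between sets of classes *)

(** Through [rel], which is total on both sides and matches [r] with [r'], the relation [r] inherits
    from [r'] that it is an equivalence. Hence only [r'] carries such hypotheses. *)
Lemma quotient_bijection (T T' : Type) (r : T -> T -> Prop)
    (r' : T' -> T' -> Prop) (rel : T -> T' -> Prop) :
  (forall y, r' y y) ->
  (forall x y z, r' x z -> r' y z -> r' x y) ->
  (forall x, exists y, rel x y) -> (forall y, exists x, rel x y) ->
  (forall x1 x2 y1 y2, rel x1 y1 -> rel x2 y2 -> (r x1 x2 <-> r' y1 y2)) ->
  exists F : quotient_set r -> quotient_set r', bijective F.
Proof.
move=> refl' eucl' /choice[u uP] /choice[v vP] rr'.
have class_eq' y1 y2 : r' y1 y2 -> r' y1 = r' y2.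
  have sym' a b : r' a b -> r' b a by move=> rab; exact: eucl' (refl' b) rab.
  move=> r12; apply/funext => z; apply/propext; split=> rz.
    exact: eucl' (sym' _ _ r12) (sym' _ _ rz).
  exact: eucl' r12 (sym' _ _ rz).
have class_eq x1 x2 : r x1 x2 -> r x1 = r x2.
  move=> /(rr' _ _ _ _ (uP x1) (uP x2))/class_eq' e.
  apply/funext => z; apply/propext.
  by rewrite (rr' _ _ _ _ (uP x1) (uP z)) (rr' _ _ _ _ (uP x2) (uP z)) e.
pose cls x : quotient_set r := exist _ (r x) (ex_intro _ x erefl).
pose cls' y : quotient_set r' := exist _ (r' y) (ex_intro _ y erefl).
have cls_eq x1 x2 : r x1 x2 -> cls x1 = cls x2.
  by move=> r12; apply: eq_exist; exact: class_eq.
have cls_eq' y1 y2 : r' y1 y2 -> cls' y1 = cls' y2.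
  by move=> r12; apply: eq_exist; exact: class_eq'.
have cls_inv x1 x2 : cls x1 = cls x2 -> r x1 x2.
  by move=> /(congr1 sval) /= ->; apply/(rr' _ _ _ _ (uP x2) (uP x2)).
have cls_inv' y1 y2 : cls' y1 = cls' y2 -> r' y1 y2.
  by move=> /(congr1 sval) /= ->.
have [|rep repK] := @choice _ _ (fun C x => cls x = C).
  move=> [C eC]; have [x ex] := eC.
  by exists x; apply: eq_exist.
have [|rep' repK'] := @choice _ _ (fun C y => cls' y = C).
  move=> [C eC]; have [y ey] := eC.
  by exists y; apply: eq_exist.
(* Each map picks a representative, passes to a partner under [rel] and takes its class. A second
   choice of representative changes it only within its class, so the composites are identities. *)
exists (cls' \o u \o rep), (cls \o v \o rep') => C /=.
  rewrite -[RHS]repK; apply: cls_eq; apply/(rr' _ _ _ _ (vP _) (uP _)).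
  exact/cls_inv'/repK'.
rewrite -[RHS]repK'; apply: cls_eq'; apply/(rr' _ _ _ _ (uP _) (vP _)).
exact/cls_inv/repK.
Qed.

Theorem theorem4p6 (k : fieldType) (M : matchedPair k) (V W : lmodType k)
    (R : mpRepr M V W) :
  exists F : Ext R -> H2 R, bijective F.
Proof.
(* A relation is used because the cocycle of an extension depends on the sections. *)
apply: (quotient_bijection (rel := fun E c =>
  exists s1 s2, presents R (E := sval E) (sval c) s1 s2)).
- by move=> c; apply: cohomologous_refl.
- by move=> c c' c''; apply: cohomologous_eucl.
- move=> [E indE]; have [c [s1 [s2 P]]] := presents_exists indE.
  by exists (exist _ c (presents_cocycle P)), s1, s2.
- move=> [c cP]; exists (exist _ (twist_ext cP) (twist_ext_induces cP)).
  exact: twist_ext_presented.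
move=> [E1 ?] [E2 ?] [c1 ?] [c2 ?] /= [s1 [s2 P1]] [t1 [t2 P2]]; split.
  (* The isomorphism carries the presentation of [E1] by [c1] to [E2], which [c2] presents as
     well. *)
  move=> [f [g [fg_mor _ _ [fi gi] [fj gj]]]].
  exact: presents_cohomologous (presents_transport fg_mor fi gi fj gj P1) P2.
(* Conversely, shifting the sections of [E2] by [N1] and [N2] turns its cochain [c2] into [c1], and
   both extensions are presented by [c1]. *)
move=> /cohomologousP[N1 [N2 c1E]].
have P2' := @presents_shift _ _ _ _ _ _ _ t1 t2 (t1 \+ (ext_i1 E2 \o N1))
  (t2 \+ (ext_i2 E2 \o N2)) N1 N2 P2 (fun=> erefl) (fun=> erefl).
by rewrite -c1E in P2'; apply: presents_isomorphic P1 P2'.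
Qed.
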